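(* Let $n\in\mathbb{N}$, let $E=E(\mathbb{R}^n)$ be a rearrangement-invariant space, and let $\Phi\in B_n(\infty)$. Then the cones $K_1$, $K_2$, $K_3$ (defined in the context) are equivalent: $$K_1\approx K_2\approx K_3 .$$
   Context: A rearrangement-invariant space (RIS) $E=E(\mathbb{R}^n)$ is a Banach function space (in the sense of Bennett–Sharpley) on $\mathbb{R}^n$ with Lebesgue measure whose norm satisfies $\|f\|_E\le\|g\|_E$ whenever $f^*\le g^*$. For measurable $f$, $f^*(t)=\inf\{y>0:\ |\{x:|f(x)|>y\}|\le t\}$ is the nonincreasing rearrangement and $f^{**}(t)=\frac1t\int_0^t f^*(\tau)\,d\tau$, $t>0$. Class $B_n(\infty)$: a function $\Phi:(0,\infty)\to(0,\infty)$ belongs to $B_n(\infty)$ if $\Phi$ is decreasing and continuous on $(0,\infty)$ and there is $C>0$ with $\int_0^r\Phi(\rho)\rho^{n-1}\,d\rho\le C\,\Phi(r)r^n$ for all $r\in(0,\infty)$. Generalized fractional maximal function: for $f\in E\cap L^1_{loc}(\mathbb{R}^n)$, $(M_\Phi f)(x)=\sup_{r>0}\Phi(r)\int_{B(x,r)}|f(y)|\,dy$, where $B(x,r)$ is the ball of center $x$, radius $r$. The space $M_E^\Phi=M_E^\Phi(\mathbb{R}^n)$ consists of all $u$ such that $u=M_\Phi f$ for some $f\in E$, with $\|u\|_{M_E^\Phi}=\inf\{\|f\|_E:\ f\in E,\ M_\Phi f=u\}$. Cones (sets of nonnegative measurable functions on $(0,\infty)$ with positive homogeneous functionals): $K_1=\{h:\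 h=u^*\text{ on }(0,\infty)\text{ for some }u\in M_E^\Phi\}$, $\rho_{K_1}(h)=\inf\{\|u\|_{M_E^\Phi}: u\in M_E^\Phi,\ u^*=h\}$; $K_2=\{h:\ h=u^{**}\text{ for some }u\in M_E^\Phi\}$, $\rho_{K_2}(h)=\inf\{\|u\|_{M_E^\Phi}: u\in M_E^\Phi,\ u^{**}=h\}$; $K_3=\{h:\ h(t)=\sup_{t<\tau<\infty}\tau\Phi(\tau^{1/n})u^{**}(\tau)\ \forall t>0,\text{ for some }u\in E\}$, $\rho_{K_3}(h)=\inf\{\|u\|_E: u\in E,\ \sup_{t<\tau<\infty}\tau\Phi(\tau^{1/n})u^{**}(\tau)=h(t)\ \forall t>0\}$. Covering: for two such cones $M,K$, we write $M\prec K$ ($K$ covers $M$) if there is $C_0>0$ such that for every $h_1\in M$ there exists $h_2\in K$ with $\rho_K(h_2)\le C_0\rho_M(h_1)$ and $h_1(t)\le h_2(t)$ for all $t\in(0,\infty)$. Equivalence $M\approx K$ means $M\prec K$ and $K\prec M$. *)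

(* Defs.v *)
From HB Require Import structures.
From mathcomp Require Import all_boot all_order all_algebra.
From mathcomp Require Import all_classical all_reals all_analysis.
From mathcomp Require Import measurable_realfun.
Import Order.TTheory GRing.Theory Num.Theory.
Import numFieldNormedType.Exports.
Set Implicit Arguments. Unset Strict Implicit. Unset Printing Implicit Defensive.
Local Open Scope classical_set_scope.
Local Open Scope ring_scope.

Record mspace (R : realType) := MSpace {
  ms_disp : measure_display;
  ms_type : measurableType ms_disp;
  ms_meas : {measure set ms_type -> \bar R} }.

(* leb_space R k = R^(k+1) as iterated pairs ((..(x1,x2),..),x_(k+1)),
   with the Borel sigma-algebra and the (iterated product) Lebesgue measure. *)
Fixpoint leb_space (R : realType) (k : nat) : mspace R :=
  match k with
  | 0 => @MSpace R _ (measurableTypeR R) (@lebesgue_measure R)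
  | k'.+1 => let S := leb_space R k' in
     @MSpace R _ (ms_type S * measurableTypeR R)%type
       (product_measure1 (ms_meas S) (@lebesgue_measure R)
         : {measure set _ -> \bar R})
  end.

Fixpoint sqdist (R : realType) (k : nat) :
    ms_type (leb_space R k) -> ms_type (leb_space R k) -> R :=
  match k return ms_type (leb_space R k) -> ms_type (leb_space R k) -> R with
  | 0 => fun x y => (x - y) ^+ 2
  | k'.+1 => fun x y => sqdist x.1 y.1 + (x.2 - y.2) ^+ 2
  end.

(* R^n (meaningful for n >= 1) and its Lebesgue measure *)
Definition Rn (R : realType) (n : nat) := ms_type (leb_space R n.-1).
Definition lebn (R : realType) (n : nat) : {measure set Rn R n -> \bar R} :=
  ms_meas (leb_space R n.-1).

Definition ball_n (R : realType) (n : nat) (x : Rn R n) (r : R) : set (Rn R n) :=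
  [set y | sqdist x y < r ^+ 2].

Section BFS.
Local Open Scope ereal_scope.
Context (R : realType) (d : measure_display) (T : measurableType d)
  (mu : {measure set T -> \bar R}).

Definition nonneg_meas (f : T -> \bar R) :=
  measurable_fun setT f /\ forall x, 0 <= f x.

(* Banach function norm: axioms (P1)-(P5) of Bennett--Sharpley, Def. I.1.1 *)
Definition banach_function_norm (rho : (T -> \bar R) -> \bar R) : Prop :=
  (forall f, nonneg_meas f -> (rho f = 0 <-> {ae mu, forall x, f x = 0})) /\
  (forall f (a : R), nonneg_meas f -> (0 <= a)%R ->
      rho (fun x => a%:E * f x) = a%:E * rho f) /\
  (forall f g, nonneg_meas f -> nonneg_meas g ->
      rho (fun x => f x + g x) <= rho f + rho g) /\
  (forall f g, nonneg_meas f -> nonneg_meas g ->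
      {ae mu, forall x, g x <= f x} -> rho g <= rho f) /\
  (forall (F : nat -> T -> \bar R) f, (forall k, nonneg_meas (F k)) ->
      nonneg_meas f ->
      {ae mu, forall x, {homo (fun k => F k x) : k l / (k <= l)%N >-> k <= l}
                        /\ (fun k => F k x) @ \oo --> f x} ->
      {homo (fun k => rho (F k)) : k l / (k <= l)%N >-> k <= l} /\
      (fun k => rho (F k)) @ \oo --> rho f) /\
  (forall A, measurable A -> mu A < +oo ->
      rho (fun x => (\1_A x)%:E) < +oo) /\
  (forall A, measurable A -> mu A < +oo ->
      exists C : R, (0 <= C)%R /\
        forall f, nonneg_meas f -> \int[mu]_(x in A) f x <= C%:E * rho f).

Definition in_E (rho : (T -> \bar R) -> \bar R) (f : T -> \bar R) :=
  measurable_fun setT f /\ rho (fun x => `|f x|) < +oo.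
Definition norm_E (rho : (T -> \bar R) -> \bar R) (f : T -> \bar R) :=
  rho (fun x => `|f x|).

Definition distrib (f : T -> \bar R) (y : R) : \bar R :=
  mu [set x | y%:E < `|f x|].
Definition rearr (f : T -> \bar R) (t : R) : \bar R :=
  ereal_inf [set y%:E | y in [set y : R | (0 < y)%R /\ distrib f y <= t%:E]].
Definition rearr2 (f : T -> \bar R) (t : R) : \bar R :=
  (t^-1)%:E * \int[@lebesgue_measure R]_(s in `]0%R, t]%classic) rearr f s.

Definition ri_norm (rho : (T -> \bar R) -> \bar R) : Prop :=
  banach_function_norm rho /\
  forall f g, in_E rho f -> in_E rho g ->
    (forall t : R, (0 < t)%R -> rearr f t <= rearr g t) ->
    norm_E rho f <= norm_E rho g.

End BFS.
Arguments nonneg_meas {R d T}.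
Arguments banach_function_norm {R d T}.
Arguments in_E {R d T}.
Arguments norm_E {R d T}.
Arguments distrib {R d T}.
Arguments rearr {R d T}.
Arguments rearr2 {R d T}.
Arguments ri_norm {R d T}.

Definition class_Bn (R : realType) (n : nat) (Phi : R -> R) : Prop :=
  (forall r s, 0 < r -> r <= s -> Phi s <= Phi r) /\
  (forall r, 0 < r -> 0 < Phi r) /\
  (forall r, 0 < r -> {for r, continuous Phi}) /\
  exists C : R, 0 < C /\ forall r : R, 0 < r ->
    (\int[@lebesgue_measure R]_(s in `]0%R, r[%classic) (Phi s * s ^+ n.-1)%:E
       <= (C * Phi r * r ^+ n)%:E)%E.

(** * Cones of functions on (0,oo) with a positively homogeneous functional
    (represented by a membership predicate and the functional rho_K) *)
Record cone (R : realType) := Cone {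
  cone_mem : (R -> \bar R) -> Prop;
  cone_rho : (R -> \bar R) -> \bar R }.

Section Maximal.
Local Open Scope ereal_scope.
Context (R : realType) (n : nat) (rho : (Rn R n -> \bar R) -> \bar R)
  (Phi : R -> R).

Definition frac_max (f : Rn R n -> \bar R) (x : Rn R n) : \bar R :=
  ereal_sup [set (Phi r)%:E * \int[lebn R n]_(y in ball_n x r) `|f y|
            | r in [set r : R | (0 < r)%R]].

Definition in_MEPhi (u : Rn R n -> \bar R) : Prop :=
  exists f, in_E rho f /\ frac_max f = u.
Definition norm_MEPhi (u : Rn R n -> \bar R) : \bar R :=
  ereal_inf [set norm_E rho f | f in [set f | in_E rho f /\ frac_max f = u]].


Definition K1 : cone R := Cone
  (fun h => exists u, in_MEPhi u /\ forall t, (0 < t)%R -> h t = rearr (lebn R n) u t)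
  (fun h => ereal_inf [set norm_MEPhi u | u in
     [set u | in_MEPhi u /\ forall t, (0 < t)%R -> rearr (lebn R n) u t = h t]]).

Definition K2 : cone R := Cone
  (fun h => exists u, in_MEPhi u /\ forall t, (0 < t)%R -> h t = rearr2 (lebn R n) u t)
  (fun h => ereal_inf [set norm_MEPhi u | u in
     [set u | in_MEPhi u /\ forall t, (0 < t)%R -> rearr2 (lebn R n) u t = h t]]).

Definition K3fun (u : Rn R n -> \bar R) (t : R) : \bar R :=
  ereal_sup [set (tau * Phi (tau `^ (n%:R)^-1))%:E * rearr2 (lebn R n) u tau
            | tau in [set tau : R | (t < tau)%R]].

Definition K3 : cone R := Cone
  (fun h => exists u, in_E rho u /\ forall t, (0 < t)%R -> h t = K3fun u t)
  (fun h => ereal_inf [set norm_E rho u | u in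
     [set u | in_E rho u /\ forall t, (0 < t)%R -> K3fun u t = h t]]).

End Maximal.

Definition covered_by (R : realType) (M K : cone R) : Prop :=
  exists C0 : R, 0 < C0 /\
    forall h1, cone_mem M h1 ->
      exists h2, cone_mem K h2 /\
        (cone_rho K h2 <= C0%:E * cone_rho M h1)%E /\
        forall t, 0 < t -> (h1 t <= h2 t)%E.

Definition cone_equiv (R : realType) (M K : cone R) : Prop :=
  covered_by M K /\ covered_by K M.

(* Main.v *)
(* Write phi(t) = Phi(t^(1/n)) and F(t) = \int_0^t f^*, so that the functional
   defining K3 is sup_{tau > t} phi(tau) F(tau).

   K1 < K2 is u^* <= u^**. For K2 < K3, cut |f| at height f^*(t). The bounded part
   contributes at most a multiple of the K3 functional at t, uniformly in x. The
   excess g has integral at most F(t), and since Phi is decreasing,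
   (M_Phi g)(x) <= \int Phi(|x - y|) |g(y)| dy; integrating this over a set of
   measure > s and using the B_n condition on the radial integrals of Phi gives
   (M_Phi g)^*(s) <= C phi(s) F(t) without any covering lemma, and phi is
   integrable near 0, again by B_n. For K3 < K1, replace u by its symmetrization
   f(x) = u^*((2|x|_oo)^n): the ball of radius comparable to tau^(1/n) around any x
   of the cube of volume tau contains that cube, so M_Phi f >= c phi(tau) F(tau)
   there.

   Rearrangements, radial integrals and symmetrizations are all compared by one
   principle: if the level sets of g are no larger than those of h, the integral
   of g is at most the integral of h (layer cake). *)
Require Import Defs.
From HB Require Import structures.
From mathcomp Require Import all_boot all_order all_algebra.
From mathcomp Require Import all_classical all_reals all_analysis.
From mathcomp Require Import measurable_realfun ring lra.
Import Order.TTheory GRing.Theory Num.Theory.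
Import numFieldNormedType.Exports.
Local Open Scope classical_set_scope.
Local Open Scope ring_scope.
Set Implicit Arguments. Unset Strict Implicit. Unset Printing Implicit Defensive.

(** Pointwise bounds between the operators do not yet give coverings. The functionals of the cones
    are infima over all functions generating the same [h]; such an infimum need not be attained, and
    it may vanish although [h] does not. If it is positive, an almost minimal generator costs a
    factor 2. If it vanishes, the covering function is taken to be +oo, and one has to show that +oo
    lies in the covering cone with functional 0; this works because each operator involved gives
    either 0 at every [t] or a positive value at every [t]. A second obstacle is that rearrangement
    invariance compares norms only of functions already known to lie in E, so the symmetrization of
    [u] has to be brought into E by bounded truncations and monotone limits. The bound for the
    rearrangement of M_Phi f at [s] keeps the cutting level [t] as an independent parameter. With
    [t] fixed, it can be integrated over [s] in ]0, t], which yields the averaged rearrangement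
    directly. Volumes are always those of sup-norm cubes, which are exact. Euclidean balls are
    compared with cubes by inclusion, and the change of radius is paid for by a doubling property of
    Phi. *)

Section measure_prelims.
Local Open Scope ereal_scope.
Context (R : realType).
Implicit Types (a b : \bar R).

(** Reduces an extended inequality to positive real levels, the ones at which distribution functions
    are controlled; it also covers [a = +oo]. *)
Lemma le_by_pos_reals a b : 0 <= b ->
  (forall y : R, (0 < y)%R -> y%:E < a -> y%:E <= b) -> a <= b.
Proof.
move=> b0 H; rewrite leNgt; apply/negP => ba.
have bfin : b \is a fin_num.
  by rewrite ge0_fin_numE//; apply: lt_le_trans ba (leey _).
rewrite -(fineK bfin) in b0 ba H.
rewrite lee_fin in b0.
case: a ba H => [x| |] //.
- rewrite lte_fin => bx H.
  have y0 : (0 < (fine b + x) / 2)%R.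
    by rewrite divr_gt0// ltr_wpDl// (le_lt_trans b0).
  have := H _ y0; rewrite lte_fin lee_fin midf_lt// => /(_ isT).
  by rewrite leNgt midf_lt.
- move=> _ H.
  have := H (fine b + 1)%R; rewrite ltr_wpDl// ltry lee_fin => /(_ isT isT).
  by rewrite gerDl ler10.
Qed.

Lemma measurable_gt_set d (T : measurableType d) (f : T -> \bar R) a : measurable_fun setT f ->
  measurable [set x | a < f x].
Proof.
by move=> mf; rewrite -[X in measurable X]setTI; exact: emeasurable_fun_o_infty.
Qed.

Lemma measurable_fun_gt_sets d (T : measurableType d) (D : set T) (f : T -> \bar R) : measurable D ->
  (forall y : R, measurable (D `&` [set x | y%:E < f x])) ->
  measurable_fun D f.
Proof.
move=> mD H.
apply: (measurability _ (ErealGenOInfty.measurableE R)).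
move=> _ [_ [y ->] <-].
rewrite (_ : _ @^-1` _ = [set x | y%:E < f x])//.
by apply/seteqP; split => x /=; rewrite in_itv/= andbT.
Qed.

(** Superlevel sets of a monotone function are intervals. *)
Lemma nonincreasing_emeasurable (D : set R) (f : R -> \bar R) : measurable D ->
  (forall s t : R, (s <= t)%R -> f t <= f s) ->
  measurable_fun D (f : measurableTypeR R -> \bar R).
Proof.
move=> mD nf; apply: measurable_fun_gt_sets => // y; apply: measurableI => //.
apply: is_interval_measurable => s t /= ys yt z /andP[sz zt].
by apply: (lt_le_trans yt); exact: nf.
Qed.

End measure_prelims.

(** * Layer cake formula and comparison of integrals through level sets *)

Section layer_cake.
Local Open Scope ereal_scope.
Context (R : realType).

(** Tonelli on the region [S] under the graph of [g]. [F] is set to 0 at nonpositive levels so that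
    the outer integral runs over the whole line. The weight [w] makes room for a density, such as
    the Jacobian of polar coordinates. *)
Lemma layer_cake d (T : measurableType d)
    (mu : {sigma_finite_measure set T -> \bar R}) (g w : T -> \bar R) :
  measurable_fun setT g -> (forall x, 0 <= g x) ->
  measurable_fun setT w -> (forall x, 0 <= w x) ->
  let F y := if (0 < y)%R then \int[mu]_(x in [set x | y%:E < g x]) w x else 0 in
  measurable_fun setT (F : measurableTypeR R -> \bar R) /\
  \int[mu]_x (w x * g x) = \int[@lebesgue_measure R]_y F y.
Proof.
move=> mg g0 mw w0 F.
pose S := [set z : T * measurableTypeR R | (0 < z.2)%R /\ z.2%:E < g z.1].
have mS : measurable S.
  apply: measurableI.
  - rewrite -[X in measurable X]setTI.
    have := @measurable_fun_ltr _ _ R (setT : set (T * measurableTypeR R))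
       (cst 0%R) snd (@measurable_cst _ _ _ _ _ _) measurable_snd.
    by move=> /(_ measurableT [set true]); apply.
  - rewrite -[X in measurable X]setTI.
    apply: measurable_lte => //.
    + by apply/measurable_EFinP; exact: measurable_snd.
    + exact: measurableT_comp mg measurable_fst.
pose K (z : T * measurableTypeR R) : \bar R := w z.1 * (\1_S z)%:E.
have mK : measurable_fun setT K.
  apply: emeasurable_funM; first exact: measurableT_comp mw measurable_fst.
  by apply/measurable_EFinP; exact: measurable_indic.
have K0 z : 0 <= K z by rewrite /K mule_ge0// lee_fin.
have FE y : F y = \int[mu]_x K (x, y).
  rewrite /F; case: ifPn => y0; last first.
    rewrite integral0_eq// => x _; rewrite /K/= indicE memNset ?mule0//.
    by move=> [/=]; rewrite (negbTE y0).
  rewrite integral_mkcond; apply: eq_integral => x _.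
  rewrite /K patchE/= indicE; have [yx|yx] := boolP (y%:E < g x).
    by rewrite !mem_set//= mule1.
  rewrite memNset; last exact/negP.
  by rewrite memNset ?mule0//= => -[_]; rewrite (negbTE yx).
split.
  rewrite (_ : F = fun y => \int[mu]_x K (x, y)); last exact/funext.
  exact: measurable_fun_fubini_tonelli_G.
rewrite (eq_integral (fun y => \int[mu]_x K (x, y))); last by move=> y _.
rewrite -(fubini_tonelli K mK K0); apply: eq_integral => x _ /=.
rewrite /K/= ge0_integralZl//; last first.
  have mSx : measurable_fun setT (fun y : measurableTypeR R => \1_S (x, y) : R).
    exact/measurable_fun_pair2/measurable_indic.
  exact/measurable_EFinP.
congr (_ * _).
rewrite (_ : (fun y => _) = (fun y => (\1_(xsection S x) y)%:E)); last first.
  by apply/funext => y; rewrite !indicE mem_xsection.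
rewrite integral_indic ?setIT//; last exact: measurable_xsection.
(* The section of [S] at [x] is ]0, g x[, of length [g x], also when [g x] is 0 or infinite. *)
rewrite (_ : xsection S x = [set y : R | (0 < y)%R /\ y%:E < g x]); last first.
  by apply/seteqP; split => y; rewrite /xsection/= inE.
have := g0 x; case: (g x) => [r|_|//].
- rewrite lee_fin => r0.
  have -> : [set y : R | (0 < y)%R /\ y%:E < r%:E] = `]0%R, r[%classic.
    by apply/seteqP; split => y /=; rewrite in_itv/= lte_fin => /andP.
  have := lebesgue_measure_itv `]0%R, r[; rewrite /= lte_fin oppr0 adde0 => ->.
  by case: ltrP => // r0'; congr EFin; apply/eqP; rewrite eq_le r0 r0'.
- have -> : [set y : R | (0 < y)%R /\ y%:E < +oo] = `]0%R, +oo[%classic.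
    by apply/seteqP; split => y /=; rewrite in_itv/= andbT ltry => // -[].
  by have := lebesgue_measure_itv (`]0%R, +oo[ : interval R); rewrite /= ltry => ->.
Qed.

Lemma le_integral_level_sets d1 d2 (X : measurableType d1) (Y : measurableType d2)
    (mu : {sigma_finite_measure set X -> \bar R})
    (nu : {sigma_finite_measure set Y -> \bar R})
    (g : X -> \bar R) (h w : Y -> \bar R) :
  measurable_fun setT g -> (forall x, 0 <= g x) ->
  measurable_fun setT h -> (forall x, 0 <= h x) ->
  measurable_fun setT w -> (forall x, 0 <= w x) ->
  (forall y : R, (0 < y)%R ->
    mu [set x | y%:E < g x] <= \int[nu]_(s in [set s | y%:E < h s]) w s) ->
  \int[mu]_x g x <= \int[nu]_s (w s * h s).
Proof.
move=> mg g0 mh h0 mw w0 H.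
have [mF1 E1] := layer_cake mu mg g0 (@measurable_cst _ _ X _ setT 1) (fun _ => lee01).
have [mF2 E2] := layer_cake nu mh h0 mw w0.
under [leLHS]eq_integral do rewrite -(mul1e (g _)).
rewrite E1 E2; apply: ge0_le_integral => //.
- by move=> y _; case: ifP => // _; apply: integral_ge0 => x _ //=; rewrite lee01.
- move=> y _; case: ifPn => // y0.
  by rewrite integral_cst ?mul1e; [exact: H|exact: measurable_gt_set].
Qed.

Lemma le_integral_level_sets1 d1 d2 (X : measurableType d1) (Y : measurableType d2)
    (mu : {sigma_finite_measure set X -> \bar R})
    (nu : {sigma_finite_measure set Y -> \bar R})
    (g : X -> \bar R) (h : Y -> \bar R) :
  measurable_fun setT g -> (forall x, 0 <= g x) ->
  measurable_fun setT h -> (forall x, 0 <= h x) ->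
  (forall y : R, (0 < y)%R ->
    mu [set x | y%:E < g x] <= nu [set s | y%:E < h s]) ->
  \int[mu]_x g x <= \int[nu]_s h s.
Proof.
move=> mg g0 mh h0 H; under [leRHS]eq_integral do rewrite -(mul1e (h _)).
apply: le_integral_level_sets => //=.
move=> y y0; rewrite integral_cst ?mul1e; [exact: H|exact: measurable_gt_set].
Qed.

End layer_cake.

(** * Distribution functions and rearrangements *)

Section rearrangement.
Local Open Scope ereal_scope.
Context (R : realType) (d : measure_display) (T : measurableType d)
  (mu : {measure set T -> \bar R}).
Implicit Types (f g : T -> \bar R) (s t y : R).

Lemma measurable_distrib_set f y : measurable_fun setT f ->
  measurable [set x | y%:E < `|f x|].
Proof. by move=> mf; apply: measurable_gt_set; exact: measurableT_comp. Qed.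

Lemma le_distrib f g y : measurable_fun setT f -> measurable_fun setT g ->
  (forall x, `|f x| <= `|g x|) -> distrib mu f y <= distrib mu g y.
Proof.
move=> mf mg fg; apply: le_measure; rewrite ?inE; try exact: measurable_distrib_set.
by move=> x /= /lt_le_trans; apply.
Qed.

Lemma distrib_nonincreasing f y z : measurable_fun setT f -> (y <= z)%R ->
  distrib mu f z <= distrib mu f y.
Proof.
move=> mf yz; apply: le_measure; rewrite ?inE; try exact: measurable_distrib_set.
by move=> x /=; apply: le_lt_trans; rewrite lee_fin.
Qed.

(** Right-continuity of the distribution function: {|f| > y} is the increasing union of the sets
    {|f| > y + 1/(k+1)}, so the measure is continuous from below along them. *)
Lemma distrib_le_right f y (b : \bar R) : measurable_fun setT f ->
  (forall z, (y < z)%R -> distrib mu f z <= b) -> distrib mu f y <= b.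
Proof.
move=> mf H.
pose F k := [set x | (y + k.+1%:R^-1)%:E < `|f x|].
have mF k : measurable (F k) by exact: measurable_distrib_set.
have FU : [set x | y%:E < `|f x|] = \bigcup_k F k.
  apply/seteqP; split => x /=; last first.
    by move=> [k _] /=; apply: lt_trans; rewrite lte_fin ltrDl invr_gt0 ltr0Sn.
  move=> yx; have [z yz zx] : exists2 z, (y < z)%R & z%:E <= `|f x|.
    move: yx; case: `|f x| => [r| |]//.
    - by rewrite lte_fin => yr; exists r.
    - by move=> _; exists (y + 1)%R; rewrite ?ltrDl// leey.
  have yz0 : (0 < z - y)%R by rewrite subr_gt0.
  have [k] := ltr_add_invr yz => kz.
  by exists k => //=; apply: lt_le_trans zx; rewrite lte_fin.
have ndF : {homo F : n m / (n <= m)%N >-> (n <= m)%O}.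
  move=> n m nm; apply/subsetPset => x /=; apply: le_lt_trans.
  by rewrite lee_fin lerD2l lef_pV2 ?posrE ?ltr0Sn// ler_nat ltnS.
have := nondecreasing_cvg_mu (mu := mu) mF (bigcupT_measurable _ mF) ndF.
rewrite /distrib FU => cF; rewrite -(cvg_lim _ cF)//.
apply: lime_le; first by apply/cvg_ex; eexists; exact: cF.
by apply: nearW => k /=; apply: H; rewrite ltrDl invr_gt0 ltr0Sn.
Qed.

Lemma rearr_ge0 f t : 0 <= rearr mu f t.
Proof. by apply: le_ereal_inf_tmp => _ [y [y0 _] <-]; rewrite lee_fin ltW. Qed.

Lemma rearr_nonincreasing f s t : (s <= t)%R -> rearr mu f t <= rearr mu f s.
Proof.
move=> st; apply: ereal_inf_le_tmp => _ [y [y0 yd] <-]; exists y => //; split => //.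
by rewrite (le_trans yd)// lee_fin.
Qed.

(** The rearrangement and the distribution function are generalized inverses. Right-continuity makes
    the correspondence exact with strict inequalities, so superlevel sets of [rearr] are known
    without error terms. *)
Lemma lt_rearr f y t : measurable_fun setT f -> (0 <= y)%R ->
  (y%:E < rearr mu f t) = (t%:E < distrib mu f y).
Proof.
move=> mf y0; apply/idP/idP.
- move=> yt; rewrite ltNge; apply/negP => dt.
  have : forall e : R, (0 < e)%R -> rearr mu f t <= y%:E + e%:E.
    move=> e e0; apply: ereal_inf_lbound; exists (y + e)%R => //.
    split; first by rewrite ltr_wpDl.
    by apply: le_trans dt; apply: distrib_nonincreasing; rewrite ?lerDl ?ltW.
  by move/lee_addgt0Pr; rewrite leNgt yt.
- move=> td; rewrite ltNge; apply/negP => ry; move: td; apply/negP; rewrite -leNgt.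
  apply: distrib_le_right => // z yz.
  have /ereal_inf_lt[_ [v [v0 vt] <-]] : rearr mu f t < z%:E.
    by rewrite (le_lt_trans ry)// lte_fin.
  by rewrite lte_fin => /ltW vz; apply: le_trans vt; exact: distrib_nonincreasing.
Qed.

Lemma measurable_rearr f (D : set R) : measurable D ->
  measurable_fun D (rearr mu f : measurableTypeR R -> \bar R).
Proof.
by move=> mD; apply: nonincreasing_emeasurable => // *; exact: rearr_nonincreasing.
Qed.

Lemma le_rearr f g t : measurable_fun setT f -> measurable_fun setT g ->
  (forall x, `|f x| <= `|g x|) -> rearr mu f t <= rearr mu g t.
Proof.
move=> mf mg fg; apply: ereal_inf_le_tmp => _ [y [y0 yd] <-]; exists y => //.
by split => //; apply: le_trans yd; exact: le_distrib.
Qed.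

Lemma rearr_scale_le f (l : R) t : (0 < l)%R ->
  l%:E * rearr mu f t <= rearr mu (fun x => l%:E * f x) t.
Proof.
move=> l0; apply: le_ereal_inf_tmp => _ [y [y0 yd] <-].
rewrite -lee_pdivlMl//; apply: ereal_inf_lbound; exists (l^-1 * y)%R => //.
split; first by rewrite mulr_gt0 ?invr_gt0.
move: yd; rewrite /distrib (_ : [set x | y%:E < _] =
  [set x | (l^-1 * y)%:E < `|f x|])//.
apply/funext => x; apply/propext => /=.
by rewrite abseM (@gee0_abs _ l%:E) ?lee_fin ?ltW// EFinM lte_pdivrMl.
Qed.

Lemma eq_rearr d' (T' : measurableType d') (nu : {measure set T' -> \bar R})
    f (g : T' -> \bar R) t :
  (forall y, (0 < y)%R -> distrib mu f y = distrib nu g y) ->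
  rearr mu f t = rearr nu g t.
Proof.
move=> fg; congr ereal_inf; apply/seteqP; split => _ [y [y0 yd] <-];
  by exists y => //; split => //; rewrite ?fg// -fg.
Qed.

Lemma le_rearr_of_distrib f (b : R) t : (0 <= b)%R ->
  (forall y, (b < y)%R -> distrib mu f y <= t%:E) -> rearr mu f t <= b%:E.
Proof.
move=> b0 H; apply/lee_addgt0Pr => e e0; apply: ereal_inf_lbound.
exists (b + e)%R => //; split; first by rewrite ltr_wpDl.
by apply: H; rewrite ltrDl.
Qed.

Definition intrearr f t : \bar R :=
  \int[@lebesgue_measure R]_(s in `]0%R, t]%classic) rearr mu f s.

Lemma intrearr_ge0 f t : 0 <= intrearr f t.
Proof. by apply: integral_ge0 => s _; exact: rearr_ge0. Qed.

Lemma intrearr_nondecreasing f s t : (s <= t)%R -> intrearr f s <= intrearr f t.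
Proof.
move=> st; apply: ge0_subset_integral => //.
- exact: measurable_rearr.
- by move=> x _; exact: rearr_ge0.
- by move=> x /=; rewrite !in_itv/= => /andP[-> /le_trans]; apply.
Qed.

Lemma rearr_le_intrearr f t : (0 < t)%R -> t%:E * rearr mu f t <= intrearr f t.
Proof.
move=> t0; have : \int[@lebesgue_measure R]_(s in `]0%R, t]%classic) cst (rearr mu f t) s
    <= intrearr f t.
  apply: ge0_le_integral => //.
  - by move=> x _; exact: rearr_ge0.
  - exact: measurable_rearr.
  - by move=> x /=; rewrite in_itv/= => /andP[_ xt]; exact: rearr_nonincreasing.
rewrite integral_cst//.
have := lebesgue_measure_itv `]0%R, t]; rewrite /= lte_fin t0 oppr0 adde0 => ->.
by rewrite muleC.
Qed.

Lemma rearr2_ge0 f t : (0 < t)%R -> 0 <= rearr2 mu f t.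
Proof. by move=> t0; rewrite mule_ge0 ?intrearr_ge0// lee_fin invr_ge0 ltW. Qed.

Lemma rearr_le_rearr2 f t : (0 < t)%R -> rearr mu f t <= rearr2 mu f t.
Proof. by move=> t0; rewrite lee_pdivlMl// rearr_le_intrearr. Qed.

Lemma intrearrE f t : (0 < t)%R -> intrearr f t = t%:E * rearr2 mu f t.
Proof. by move=> t0; rewrite muleA -EFinM divff ?mul1e// gt_eqF. Qed.

Lemma le_intrearr f g t : measurable_fun setT f -> measurable_fun setT g ->
  (forall x, `|f x| <= `|g x|) -> intrearr f t <= intrearr g t.
Proof.
move=> mf mg fg; apply: ge0_le_integral => //; try exact: measurable_rearr.
- by move=> *; exact: rearr_ge0.
- by move=> *; exact: le_rearr.
Qed.

Lemma eq_intrearr d' (T' : measurableType d') (nu : {measure set T' -> \bar R})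
    f (g : T' -> \bar R) t :
  (forall s, (0 < s)%R -> rearr mu f s = rearr nu g s) ->
  intrearr f t = \int[@lebesgue_measure R]_(s in `]0%R, t]%classic) rearr nu g s.
Proof.
move=> fg; apply: eq_integral => s; rewrite inE/= in_itv/= => /andP[s0 _].
exact: fg.
Qed.

Lemma intrearr_scale_le f (l : R) t : (0 < l)%R ->
  l%:E * intrearr f t <= intrearr (fun x => l%:E * f x) t.
Proof.
move=> l0; rewrite -ge0_integralZl//; last 3 first.
- exact: measurable_rearr.
- by move=> *; exact: rearr_ge0.
- by rewrite lee_fin ltW.
apply: ge0_le_integral => //.
- by move=> *; rewrite mule_ge0 ?rearr_ge0// lee_fin ltW.
- by apply: measurable_funeM; exact: measurable_rearr.
- exact: measurable_rearr.
- by move=> *; exact: rearr_scale_le.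
Qed.

(** Beyond [t], [rearr] is at most its value at [t], hence at most [rearr2] there; before [t],
    [s * rearr s] is at most the integral up to [t], which is 0. This gives the zero-or-positive
    alternative that the covering argument needs. *)
Lemma rearr2_eq0 f t : (0 < t)%R -> rearr2 mu f t = 0 ->
  forall s, (0 < s)%R -> rearr mu f s = 0 /\ rearr2 mu f s = 0.
Proof.
move=> t0 ft0.
have H s : (0 < s)%R -> rearr mu f s = 0.
  move=> s0; apply/eqP; rewrite eq_le rearr_ge0 andbT.
  have [ts|st] := leP t s.
    by rewrite (le_trans (rearr_nonincreasing _ ts))// (le_trans (rearr_le_rearr2 _ t0))// ft0.
  rewrite -(lee_pmul2l (x := s%:E))// mule0 (le_trans (rearr_le_intrearr _ s0))//.
  by rewrite (le_trans (intrearr_nondecreasing _ (ltW st)))// intrearrE// ft0 mule0.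
move=> s s0; split; first exact: H.
rewrite /rearr2 integral0_eq ?mule0// => x /=; rewrite in_itv/= => /andP[x0 _].
exact: H.
Qed.

End rearrangement.

(** * Cubes, Euclidean balls and Lebesgue measure on the iterated product *)

Section euclidean_space.
Local Open Scope ereal_scope.
Context (R : realType).

(** Sup-norm distance, with the same recursion as [sqdist]. Its balls are products of intervals, so
    their volume follows exactly by induction on the iterated product measure. *)
Fixpoint supdist (k : nat) :
    ms_type (leb_space R k) -> ms_type (leb_space R k) -> R :=
  match k return ms_type (leb_space R k) -> ms_type (leb_space R k) -> R with
  | 0 => fun x y => `|x - y|%R
  | k'.+1 => fun x y => Num.max (supdist x.1 y.1) `|x.2 - y.2|%R
  end.

Fixpoint origin (k : nat) : ms_type (leb_space R k) :=
  match k return ms_type (leb_space R k) with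
  | 0 => 0%R : R
  | k'.+1 => (origin k', 0%R : R)
  end.

Lemma supdist_ge0 k (x y : ms_type (leb_space R k)) : (0 <= supdist x y)%R.
Proof.
by elim: k x y => [|k ih] x y /=; [exact: normr_ge0|rewrite le_max ih].
Qed.

Lemma sqdist_ge0 k (x y : ms_type (leb_space R k)) : (0 <= sqdist x y)%R.
Proof.
by elim: k x y => [|k ih] x y /=; [exact: sqr_ge0|rewrite addr_ge0// sqr_ge0].
Qed.

Lemma supdistC k (x y : ms_type (leb_space R k)) : supdist x y = supdist y x.
Proof.
by elim: k x y => [|k ih] x y /=; [exact: distrC|rewrite ih distrC].
Qed.

Lemma supdist_sqr_le k (x y : ms_type (leb_space R k)) :
  (supdist x y ^+ 2 <= sqdist x y)%R.
Proof.
elim: k x y => [|k ih] x y /=; first by rewrite real_normK// num_real.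
rewrite maxEle; case: ifP => _.
- by rewrite real_normK ?num_real// lerDr sqdist_ge0.
- by rewrite (le_trans (ih _ _))// lerDl sqr_ge0.
Qed.

Lemma sqdist_le_cube k (z x y : ms_type (leb_space R k)) (s : R) :
  (supdist z x < s)%R -> (supdist z y < s)%R ->
  (sqdist x y <= k.+1%:R * (2 * s) ^+ 2)%R.
Proof.
have H (a b c : R) : (`|a - b| < s)%R -> (`|a - c| < s)%R ->
    ((b - c) ^+ 2 <= (2 * s) ^+ 2)%R.
  move=> ab ac; have s0 : (0 < s)%R by apply: le_lt_trans ab.
  rewrite -(@real_normK _ (b - c)%R) ?num_real// ler_pXn2r ?nnegrE ?mulr_ge0 ?(ltW s0)//.
  rewrite (_ : (b - c = (a - c) - (a - b))%R); last by ring.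
  by rewrite (le_trans (ler_normB _ _))// mulrDl mul1r lerD// ltW.
elim: k z x y => [|k ih] z x y /=; first by rewrite mul1r; exact: H.
rewrite !gt_max => /andP[zx1 zx2] /andP[zy1 zy2].
rewrite -[k.+2%:R]natr1 mulrDl mul1r lerD//; first exact: ih zx1 zy1.
exact: H zx2 zy2.
Qed.

Lemma measurable_supdist k : measurable_fun setT
  (fun z : ms_type (leb_space R k) * ms_type (leb_space R k) => supdist z.1 z.2).
Proof.
elim: k => [|k ih].
  apply: measurableT_comp => //; apply: measurable_funB.
  - exact: measurable_fst.
  - exact: measurable_snd.
apply: measurable_maxr.
  exact: (measurableT_comp ih (measurable_fun_pair
    (measurableT_comp measurable_fst measurable_fst)
    (measurableT_comp measurable_fst measurable_snd))).
apply: measurableT_comp => //; apply: measurable_funB.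
- exact: measurableT_comp measurable_snd measurable_fst.
- exact: measurableT_comp measurable_snd measurable_snd.
Qed.

Lemma measurable_sqdist k : measurable_fun setT
  (fun z : ms_type (leb_space R k) * ms_type (leb_space R k) => sqdist z.1 z.2).
Proof.
elim: k => [|k ih].
  apply: measurable_funX; apply: measurable_funB.
  - exact: measurable_fst.
  - exact: measurable_snd.
apply: measurable_funD.
  exact: (measurableT_comp ih (measurable_fun_pair
    (measurableT_comp measurable_fst measurable_fst)
    (measurableT_comp measurable_fst measurable_snd))).
apply: measurable_funX; apply: measurable_funB.
- exact: measurableT_comp measurable_snd measurable_fst.
- exact: measurableT_comp measurable_snd measurable_snd.
Qed.

Lemma measurable_cube k (x : ms_type (leb_space R k)) (s : R) :
  measurable [set y | (supdist x y < s)%R].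
Proof.
have := measurable_fun_ltr (measurable_fun_pair2 x (@measurable_supdist k))
  (@measurable_cst _ _ _ _ _ s).
by move=> /(_ measurableT [set true]); rewrite setTI; apply.
Qed.

Lemma cube_measure k (x : ms_type (leb_space R k)) (s : R) : (0 < s)%R ->
  ms_meas (leb_space R k) [set y | (supdist x y < s)%R] = ((2 * s) ^+ k.+1)%:E.
Proof.
move=> s0.
have H (a : R) : @lebesgue_measure R [set y : R | (`|a - y|%R < s)%R] = (2 * s)%:E.
  have -> : [set y : R | (`|a - y|%R < s)%R] = `](a - s)%R, (a + s)%R[%classic.
    by apply/seteqP; split => y /=; rewrite in_itv/= ltr_distlC.
  have := lebesgue_measure_itv `](a - s)%R, (a + s)%R[; rewrite /= => ->.
  rewrite lte_fin ltrBlDr -addrA ltrDl addr_gt0// -EFinB; congr EFin; ring.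
elim: k x => [|k ih] x; first exact: H.
have mS : measurable [set y : measurableTypeR R | (`|x.2 - y| < s)%R].
  exact: (@measurable_cube 0 x.2 s).
have := product_measure1E (ms_meas (leb_space R k)) (@lebesgue_measure R)
  (measurable_cube x.1 s) mS.
rewrite (ih x.1) [X in _ * X](H x.2) -EFinM -exprSr => <-.
congr (_ _); apply/seteqP; split => y /=.
- by rewrite gt_max => /andP.
- by rewrite gt_max => -[-> ->].
Qed.

Lemma leb_space_sigma_finite k : sigma_finite setT (ms_meas (leb_space R k)).
Proof.
exists (fun m => [set y | (supdist (origin k) y < m.+1%:R)%R]).
  apply/seteqP; split => // y _.
  exists (Num.truncn (supdist (origin k) y)) => //=.
  exact: truncnS_gt.
move=> m; split; first exact: measurable_cube.
by rewrite cube_measure ?ltry// ltr0Sn.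
Qed.

(* The measure lebn again, under a name that can carry a sigma-finite instance. *)
Definition leb_sfinite k : set (ms_type (leb_space R k)) -> \bar R :=
  ms_meas (leb_space R k).

HB.instance Definition _ k := isMeasure.Build _ _ _ (@leb_sfinite k)
  (measure0 (ms_meas (leb_space R k))) (measure_ge0 (ms_meas (leb_space R k)))
  (@measure_semi_sigma_additive _ _ _ (ms_meas (leb_space R k))).

HB.instance Definition _ k := Measure_isSigmaFinite.Build _ _ _
  (@leb_sfinite k) (leb_space_sigma_finite k).

End euclidean_space.

Section roots.
Context (R : realType) (m : nat).
Implicit Types s t : R.

(** Literally the power occurring in [K3fun] for dimension m+1, so the two are exchanged by
    conversion. *)
Definition nroot t : R := t `^ (m.+1%:R)^-1.

Lemma nroot_ge0 t : 0 <= nroot t. Proof. exact: powR_ge0. Qed.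

Lemma nroot_gt0 t : 0 < t -> 0 < nroot t. Proof. exact: powR_gt0. Qed.

Lemma nrootK t : 0 <= t -> nroot t ^+ m.+1 = t.
Proof.
move=> t0; rewrite -powR_mulrn ?powR_ge0// -powRrM mulVf ?powRr1//.

Qed.

Lemma nroot_exp t : 0 <= t -> nroot (t ^+ m.+1) = t.
Proof.
move=> t0; rewrite /nroot -powR_mulrn// -powRrM divff ?powRr1//.

Qed.

Lemma lt_nroot s t : 0 <= s -> 0 <= t -> (nroot s < t) = (s < t ^+ m.+1).
Proof.
move=> s0 t0; rewrite -[X in _ = (X < _)](nrootK s0).
by rewrite ltr_pXn2r// nnegrE nroot_ge0.
Qed.

Lemma le_nroot s t : 0 <= s -> s <= t -> nroot s <= nroot t.
Proof.
move=> s0 st; apply: ge0_ler_powR => //; rewrite ?nnegrE ?invr_ge0//.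
exact: le_trans st.
Qed.

Lemma measurable_nroot : measurable_fun setT (nroot : measurableTypeR R -> R).
Proof. exact: measurable_powR. Qed.

End roots.
Arguments nroot {R} m t.

(** * Consequences of the B_n condition: quasi-monotonicity, doubling, radial integrals *)

Section radial_weight.
Local Open Scope ereal_scope.
Context (R : realType) (m : nat) (Phi : R -> R) (C : R).
Hypothesis Phi_le : forall r s, (0 < r)%R -> (r <= s)%R -> (Phi s <= Phi r)%R.
Hypothesis Phi_gt0 : forall r, (0 < r)%R -> (0 < Phi r)%R.
Hypothesis C_gt0 : (0 < C)%R.
Hypothesis Phi_int : forall r : R, (0 < r)%R ->
  \int[@lebesgue_measure R]_(s in `]0%R, r[%classic) (Phi s * s ^+ m)%:E
    <= (C * Phi r * r ^+ m.+1)%:E.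

(* The value +oo at r <= 0 keeps wt nonincreasing on all of R, whatever the junk
   values of Phi there. *)
Definition wt (r : R) : \bar R := if (0 < r)%R then (Phi r)%:E else +oo.

Lemma wt_ge0 r : 0 <= wt r.
Proof. by rewrite /wt; case: ifPn => // r0; rewrite lee_fin ltW ?Phi_gt0. Qed.

Lemma wt_nonincreasing r s : (r <= s)%R -> wt s <= wt r.
Proof.
move=> rs; rewrite /wt; case: ifPn => s0.
  by case: ifPn => // r0; rewrite ?leey// lee_fin Phi_le.
by case: ifPn => // r0; move: s0; rewrite (lt_le_trans r0 rs).
Qed.

Lemma measurable_wt : measurable_fun setT (wt : measurableTypeR R -> \bar R).
Proof. apply: nonincreasing_emeasurable => // *; exact: wt_nonincreasing. Qed.

Lemma measurable_Phi_pow (a b : R) : (0 <= a)%R -> measurable_fun `]a, b[%classic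
  (fun s : measurableTypeR R => (Phi s * s ^+ m)%:E).
Proof.
move=> a0; apply: (eq_measurable_fun (fun s : measurableTypeR R => wt s * (s ^+ m)%:E)).
  move=> s; rewrite inE/= in_itv/= => /andP[as_ _].
  by rewrite /wt (le_lt_trans a0 as_).
apply: emeasurable_funM.
- exact: measurable_funS measurable_wt.
- by apply/measurable_EFinP; exact: measurable_funX.
Qed.

Lemma Phi_pow_lower (s r : R) : (0 < s)%R -> (s <= r)%R ->
  (Phi s * (s / 2) ^+ m.+1)%:E <=
  \int[@lebesgue_measure R]_(s in `]0%R, r[%classic) (Phi s * s ^+ m)%:E.
Proof.
move=> s0 sr.
apply: (@le_trans _ _ (\int[@lebesgue_measure R]_(x in `](s/2)%R, s[%classic)
    (Phi x * x ^+ m)%:E)); last first.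
  apply: ge0_subset_integral => //.
  - exact: measurable_Phi_pow.
  - move=> x /=; rewrite in_itv/= => /andP[x0 _].
    by rewrite lee_fin mulr_ge0 ?exprn_ge0 ?ltW// Phi_gt0.
  - move=> x /=; rewrite !in_itv/= => /andP[sx xs].
    by rewrite (lt_trans _ sx) ?divr_gt0// (lt_le_trans xs).
have := @integral_cst _ _ R (@lebesgue_measure R) `](s/2)%R, s[%classic
  (measurable_itv _) (Phi s * (s / 2) ^+ m)%:E.
have := lebesgue_measure_itv `](s/2)%R, s[; rewrite /= => ->.
rewrite lte_fin ltr_pdivrMr// ltr_pMr// ltr1n -EFinB -EFinM => E.
rewrite (_ : (Phi s * _)%R = (Phi s * (s / 2) ^+ m * (s - s / 2))%R); last first.
  by rewrite exprSr; field.
rewrite -E; apply: ge0_le_integral => //=.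
- by move=> x _; rewrite lee_fin mulr_ge0 ?exprn_ge0 ?divr_ge0 ?ltW// Phi_gt0.
- by apply: measurable_Phi_pow; rewrite divr_ge0 ?ltW.
- move=> x; rewrite in_itv/= => /andP[sx xs].
  have x0 : (0 < x)%R by rewrite (lt_trans _ sx) ?divr_gt0.
  rewrite lee_fin ler_pM ?exprn_ge0 ?divr_ge0 ?(ltW (Phi_gt0 _))//.
  - exact: ltW.
  - by rewrite Phi_le// ltW.
  - by rewrite lerXn2r ?nnegrE ?divr_ge0 ?ltW.
Qed.

(** The interval ]s/2, s[ alone contributes at least [Phi s * (s / 2) ^+ m.+1] to the integral up to
    [r], which B_n bounds. So Phi cannot decay essentially faster than r^(-n), and doubling
    follows. *)
Lemma Phi_pow_quasi_increasing (s r : R) : (0 < s)%R -> (s <= r)%R ->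
  (Phi s * s ^+ m.+1 <= 2 ^+ m.+1 * C * (Phi r * r ^+ m.+1))%R.
Proof.
move=> s0 sr; have := le_trans (Phi_pow_lower s0 sr) (Phi_int (lt_le_trans s0 sr)).
rewrite lee_fin (_ : (Phi s * _)%R = (Phi s * s ^+ m.+1 / 2 ^+ m.+1)%R); last first.
  by rewrite expr_div_n mulrA.
rewrite ler_pdivrMr ?exprn_gt0// => /le_trans; apply.
by rewrite le_eqVlt; apply/orP; left; apply/eqP; ring.
Qed.

Lemma Phi_doubling (l r : R) : (0 < r)%R -> (1 <= l)%R ->
  (Phi r <= (2 * l) ^+ m.+1 * C * Phi (l * r))%R.
Proof.
move=> r0 l1; have rm : (0 < r ^+ m.+1)%R by rewrite exprn_gt0.
rewrite -(ler_pM2r rm); have rl : (r <= l * r)%R by rewrite ler_peMl// ltW.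
apply: (le_trans (Phi_pow_quasi_increasing r0 rl)).
by rewrite le_eqVlt; apply/orP; left; apply/eqP; rewrite !exprMn; ring.
Qed.

Section radial_integral.
Context d (X : measurableType d) (mu : {sigma_finite_measure set X -> \bar R})
  (g : X -> R).
Hypothesis mg : measurable_fun setT g.
Hypothesis mu_g : forall s, (0 < s)%R -> mu [set x | (g x < s)%R] <= ((2 * s) ^+ m.+1)%:E.

Lemma measurable_radial_ball s : measurable [set x | (g x < s)%R].
Proof.
have := measurable_fun_ltr mg (@measurable_cst _ _ _ _ _ s).
by move=> /(_ measurableT [set true]); rewrite setTI; apply.
Qed.

Lemma measurable_wt_comp : measurable_fun setT (wt \o g).
Proof. exact: measurableT_comp measurable_wt mg. Qed.

Lemma radial_ball0 (A : set X) : measurable A ->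
  (forall e, (0 < e)%R -> A `<=` [set x | (g x < e)%R]) -> mu A <= 0.
Proof.
move=> mA H; apply/lee_addgt0Pr => e e0; rewrite add0e.
pose h := (Num.min e 1)%R.
have h0 : (0 < h)%R by rewrite lt_min e0 ltr01.
have h2 : (0 < h / 2)%R by rewrite divr_gt0.
apply: (@le_trans _ _ (mu [set x | (g x < h / 2)%R])).
  by apply: le_measure; rewrite ?inE//; [exact: measurable_radial_ball|exact: H].
apply: (le_trans (mu_g h2)); rewrite lee_fin.
rewrite (_ : (2 * (h / 2) = h)%R); last by field.
rewrite (@le_trans _ _ h)//; last by rewrite ge_min lexx.
by rewrite exprS ler_piMr ?(ltW h0)// exprn_ile1 ?(ltW h0)// ge_min lexx orbT.
Qed.

(** A polar-coordinate bound that only needs upper volume bounds for the sublevel sets of [g]. It is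
    applied to the sup distance from a point and to |s|^(1/n) on the line. *)
Lemma radial_integral r : (0 < r)%R ->
  \int[mu]_(x in [set x | (g x < r)%R]) wt (g x)
  <= (8 ^+ m.+1 * C * (Phi r * r ^+ m.+1))%:E.
Proof.
move=> r0.
(* Polar density, inflated by 8^n: one factor 2 from the volume bound, one from replacing sup S by 2
   sup S, one from integrating only over the upper half of ]0, sup S[. *)
pose w (s : measurableTypeR R) : \bar R := (8 ^+ m.+1 * `|s| ^+ m)%:E.
have mw : measurable_fun setT w.
  apply/measurable_EFinP; apply: measurable_funM => //.
  by apply: measurable_funX; exact: normr_measurable.
pose h : measurableTypeR R -> \bar R := wt \_ `]0%R, r[%classic.
have mh : measurable_fun setT h.
  by apply/(measurable_restrictT wt (measurable_itv _)); exact: measurable_funTS measurable_wt.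
have h0 s : 0 <= h s by rewrite /h patchE; case: ifP => // _; exact: wt_ge0.
have mB := measurable_radial_ball.
rewrite integral_mkcond.
apply: (@le_trans _ _ (\int[@lebesgue_measure R]_s (w s * h s))).
  apply: le_integral_level_sets => //.
  - apply/(measurable_restrictT _ (mB r)); exact: measurable_funTS measurable_wt_comp.
  - by move=> x; rewrite patchE; case: ifP => // _; exact: wt_ge0.
  - by move=> s; rewrite lee_fin mulr_ge0 ?exprn_ge0.
  move=> y y0.
  pose S := [set s : R | (0 < s < r)%R /\ y%:E < wt s].
  have -> : [set s | y%:E < h s] = S.
    apply/seteqP; split => s /=; rewrite /h patchE.
    - case: ifPn => [|_]; last by rewrite lte_fin ltNge (ltW y0).
      by rewrite inE/= in_itv/=.
    - by move=> [s0 ys]; rewrite mem_set//= in_itv.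
  set A := (X in mu X <= _).
  have AE : A = [set x | (g x < r)%R /\ y%:E < wt (g x)].
    apply/seteqP; split => x; rewrite /A/= patchE.
    - by case: ifPn => [|_]; [rewrite inE|rewrite lte_fin ltNge (ltW y0)].
    - by move=> [gr yx]; rewrite mem_set.
  have mA : measurable A.
    have mY : measurable [set x | y%:E < (wt \o g) x].
      exact: measurable_gt_set measurable_wt_comp.
    by rewrite AE; exact: measurableI (mB r) mY.
  (* If no positive radius reaches level [y], the set [A] lies in every {g < e} and is null; in
     particular the points with g <= 0, where [wt] is +oo, do no harm. *)
  have [S0|/set0P S0] := eqVneq S set0.
    rewrite S0 integral_set0; apply: radial_ball0 => // e e0 x.
    rewrite AE => -[gr yx] /=; rewrite ltNge; apply/negP => eg.
    suff : S (g x) by rewrite S0.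
    by split => //; rewrite gr (lt_le_trans e0).
  have ubS : has_ubound S by exists r => s [/andP[_ /ltW]].
  have sS : (0 < sup S)%R.
    have [s Ss] := S0; have := ub_le_sup ubS Ss; case: Ss => /andP[s0 _] _.
    exact: lt_le_trans.
  apply: (@le_trans _ _ (8 ^+ m.+1 * (sup S / 2) ^+ m.+1)%:E).
    (* Doubling [sup S] makes the inequality strict even if the supremum is attained, and covers the
       points with g <= 0. *)
    apply: (@le_trans _ _ (mu [set x | (g x < 2 * sup S)%R])).
      apply: le_measure; rewrite ?inE// AE => x [gr yx] /=.
      have [gx0|] := ltP 0%R (g x); last by move/le_lt_trans; apply; rewrite mulr_gt0.
      have : S (g x) by split; rewrite ?gx0.
      move/(ub_le_sup ubS)/le_lt_trans; apply.
      by rewrite mulrDl mul1r ltrDl.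
    apply: (le_trans (mu_g _)); first by rewrite mulr_gt0.
    rewrite lee_fin -exprMn; rewrite (_ : (2 * (2 * sup S) = 8 * (sup S / 2))%R)//.
    by field.
  (* On the upper half the density is at least its value at sup S / 2, so no primitive of s^m has to
     be computed. *)
  apply: (@le_trans _ _ (\int[@lebesgue_measure R]_(s in `](sup S / 2)%R, (sup S)%R[%classic) w s)).
    have := @integral_cst _ _ R (@lebesgue_measure R) `](sup S / 2)%R, (sup S)%R[%classic
      (measurable_itv _) (8 ^+ m.+1 * (sup S / 2) ^+ m)%:E.
    have := lebesgue_measure_itv `](sup S / 2)%R, (sup S)%R[; rewrite /= => ->.
    rewrite lte_fin ltr_pdivrMr// ltr_pMr// ltr1n -EFinB -EFinM => E.
    rewrite (_ : (8 ^+ m.+1 * _)%R = (8 ^+ m.+1 * (sup S / 2) ^+ m * (sup S - sup S / 2))%R).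
      rewrite -E; apply: ge0_le_integral => //=.
      - by move=> x _; rewrite lee_fin mulr_ge0 ?exprn_ge0 ?divr_ge0 ?ltW.
      - exact: measurable_funS mw.
      - move=> x; rewrite in_itv/= => /andP[sx xs].
        rewrite lee_fin ler_wpM2l ?exprn_ge0//.
        rewrite lerXn2r ?nnegrE ?divr_ge0 ?(ltW sS)//.
        by rewrite (le_trans (ltW sx))// ler_norm.
    by rewrite (exprSr (sup S / 2)); field.
  have mS : measurable S.
    have mY : measurable [set s | y%:E < wt s] by exact: measurable_gt_set measurable_wt.
    have <- : `]0%R, r[%classic `&` [set s | y%:E < wt s] = S.
      by apply/seteqP; split => s /=; rewrite in_itv/=.
    exact: measurableI (measurable_itv _) mY.
  apply: ge0_subset_integral => //.
  - exact: measurable_funS mw.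
  - by move=> s _; rewrite lee_fin mulr_ge0 ?exprn_ge0.
  - move=> s /=; rewrite in_itv/= => /andP[ss sS'].
    have [s' [/andP[s'0 s'r] ys'] ss'] := sup_gt S0 sS'.
    split; last by apply: (lt_le_trans ys'); apply: wt_nonincreasing; exact: ltW.
    by rewrite (lt_trans ss' s'r) (lt_trans _ ss)// divr_gt0.
apply: (@le_trans _ _ ((8 ^+ m.+1)%:E *
   \int[@lebesgue_measure R]_(s in `]0%R, r[%classic) (Phi s * s ^+ m)%:E)); last first.
  apply: (@le_trans _ _ ((8 ^+ m.+1)%:E * (C * Phi r * r ^+ m.+1)%:E)).
    by rewrite lee_wpmul2l ?Phi_int// lee_fin exprn_ge0.
  by rewrite -EFinM lee_fin le_eqVlt; apply/orP; left; apply/eqP; ring.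
rewrite -ge0_integralZl_EFin ?exprn_ge0//; last 2 first.
- move=> s /=; rewrite in_itv/= => /andP[s0 _].
  by rewrite lee_fin mulr_ge0 ?exprn_ge0 ?ltW// Phi_gt0.
- exact: measurable_Phi_pow.
rewrite [leRHS]integral_mkcond le_eqVlt; apply/orP; left; apply/eqP.
apply: eq_integral => s _; rewrite /h !patchE; case: ifPn; last by rewrite mule0.
rewrite inE/= in_itv/= => /andP[s0 _]; rewrite /w /wt s0 -!EFinM gtr0_norm//.
by congr EFin; ring.
Qed.

(** Inside {g < t^(1/n)} the radial integral is at most a multiple of [Phi (nroot m t) * t], and t
    <= mu A; outside, the weight is at most [Phi (nroot m t)], whence the summand 1. The shape of
    [A] does not enter. *)
Lemma radial_integral_set (A : set X) t : (0 < t)%R -> measurable A -> t%:E <= mu A ->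
  \int[mu]_(x in A) wt (g x) <= ((8 ^+ m.+1 * C + 1) * Phi (nroot m t))%:E * mu A.
Proof.
move=> t0 mA tA; set r := nroot m t.
have r0 : (0 < r)%R by exact: nroot_gt0.
have Pr : (0 < Phi r)%R by exact: Phi_gt0.
have mB := measurable_radial_ball r.
have mwB : measurable_fun setT ((wt \o g) \_ [set x | (g x < r)%R]).
  by apply/(measurable_restrictT _ mB); exact: measurable_funTS measurable_wt_comp.
apply: (@le_trans _ _ (\int[mu]_(x in A) (((wt \o g) \_ [set x | (g x < r)%R]) x + (Phi r)%:E))).
  apply: ge0_le_integral => //.
  - by move=> x _; exact: wt_ge0.
  - exact: measurable_funTS measurable_wt_comp.
  - by apply: emeasurable_funD => //; exact: measurable_funTS.
  - move=> x _; rewrite patchE; case: ifPn => [|].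
      by move=> _; rewrite leeDl// lee_fin ltW.
    rewrite notin_setE/= => /negP; rewrite -leNgt => rg; rewrite add0e.
    by apply: (le_trans (wt_nonincreasing rg)); rewrite /wt r0.
rewrite ge0_integralD//; last 3 first.
- by move=> x _; rewrite patchE; case: ifP => // _; exact: wt_ge0.
- exact: measurable_funTS.
- by move=> x _; rewrite lee_fin ltW.
have -> : ((8 ^+ m.+1 * C + 1) * Phi r)%:E * mu A =
    (8 ^+ m.+1 * C * Phi r)%:E * mu A + (Phi r)%:E * mu A.
  by rewrite mulrDl mul1r EFinD ge0_muleDl// lee_fin ?mulr_ge0 ?exprn_ge0 ?ltW.
rewrite integral_cst// leeD2r//.
apply: (@le_trans _ _ (8 ^+ m.+1 * C * (Phi r * r ^+ m.+1))%:E).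
  apply: le_trans (radial_integral r0); rewrite [leRHS]integral_mkcond.
  apply: ge0_subset_integral => //.
  by move=> x _; rewrite patchE; case: ifP => // _; exact: wt_ge0.
rewrite nrootK ?(ltW t0)// [X in X%:E](_ : _ = 8 ^+ m.+1 * C * Phi r * t)%R; last by ring.
by rewrite EFinM lee_wpmul2l// lee_fin !mulr_ge0 ?exprn_ge0 ?ltW.
Qed.

End radial_integral.

(** Instead of a change of variables, the radial bound is applied on the line to |s|^(1/n): its
    sublevel sets have length 2 s^n, at most (2s)^n. *)
Lemma int_Phi_nroot t : (0 < t)%R ->
  \int[@lebesgue_measure R]_(s in `]0%R, t]%classic) (Phi (nroot m s))%:E
  <= (16 ^+ m.+1 * C * (Phi (nroot m t) * t))%:E.
Proof.
move=> t0; pose g (s : measurableTypeR R) : R := nroot m `|s|.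
have mg : measurable_fun setT g.
  exact: (measurableT_comp (@measurable_nroot R m) (@normr_measurable R setT)).
have mu_g s : (0 < s)%R ->
    @lebesgue_measure R [set x | (g x < s)%R] <= ((2 * s) ^+ m.+1)%:E.
  move=> s0; have -> : [set x | (g x < s)%R] = `](- s ^+ m.+1)%R, (s ^+ m.+1)%R[%classic.
    by apply/seteqP; split => x /=; rewrite /g lt_nroot ?(ltW s0)// ltr_norml in_itv.
  have := lebesgue_measure_itv `](- s ^+ m.+1)%R, (s ^+ m.+1)%R[; rewrite /= => ->.
  rewrite lte_fin gtrN ?exprn_gt0// -EFinB lee_fin exprMn.
  rewrite (_ : s ^+ m.+1 - - s ^+ m.+1 = 2 * s ^+ m.+1)%R; last by ring.
  by rewrite ler_wpM2r ?exprn_ge0 ?(ltW s0)// exprS ler_peMr// exprn_ege1// ler1n.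
(* The radius is doubled because the sublevel set is open and must contain the endpoint [t]; this
   turns 8^n into 16^n. *)
have r0 : (0 < 2 * nroot m t)%R by rewrite mulr_gt0 ?nroot_gt0.
have le1 : \int[@lebesgue_measure R]_(s in `]0%R, t]%classic) (Phi (nroot m s))%:E <=
    \int[@lebesgue_measure R]_(x in [set x | (g x < 2 * nroot m t)%R]) wt (g x).
  rewrite (eq_integral (wt \o g)); last first.
    move=> s; rewrite inE/= in_itv/= => /andP[s0 _].
    by rewrite /wt /g gtr0_norm// nroot_gt0.
  apply: ge0_subset_integral => //.
  - exact: measurable_radial_ball.
  - exact: measurable_funTS (measurable_wt_comp mg).
  - by move=> s _; exact: wt_ge0.
  - move=> s /=; rewrite in_itv/= => /andP[s0 st].
    rewrite /g gtr0_norm// (@le_lt_trans _ _ (nroot m t)) ?le_nroot ?(ltW s0)//.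
    by rewrite ltr_pMl ?nroot_gt0// ltr1n.
have le2 := radial_integral mg mu_g r0.
apply: (le_trans le1); apply: (le_trans le2).
rewrite lee_fin exprMn nrootK ?(ltW t0)//.
rewrite (_ : (16 ^+ m.+1 = 8 ^+ m.+1 * 2 ^+ m.+1)%R); last first.
  by rewrite -exprMn; congr (_ ^+ _)%R; rewrite -natrM.
rewrite [leRHS](_ : _ = 8 ^+ m.+1 * C * (Phi (nroot m t) * (2 ^+ m.+1 * t)))%R; last by ring.
rewrite ler_wpM2l ?mulr_ge0 ?exprn_ge0 ?(ltW C_gt0)//.
rewrite ler_wpM2r ?mulr_ge0 ?exprn_ge0 ?(ltW t0)//.
by rewrite Phi_le ?nroot_gt0// ler_peMl ?nroot_ge0// ler1n.
Qed.

End radial_weight.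

(** * Hardy-Littlewood type inequalities *)

Section hardy_littlewood.
Local Open Scope ereal_scope.
Context (R : realType) (d : measure_display) (T : measurableType d)
  (mu : {sigma_finite_measure set T -> \bar R}).
Implicit Types (f : T -> \bar R) (A : set T) (s t y : R).

Definition cut_rearr f t : measurableTypeR R -> \bar R :=
  (rearr mu f : measurableTypeR R -> \bar R) \_ `]0%R, t]%classic.

Lemma measurable_cut_rearr f t : measurable_fun setT (cut_rearr f t).
Proof.
by apply/(measurable_restrictT _ (measurable_itv _)); exact: measurable_rearr.
Qed.

Lemma cut_rearr_ge0 f t s : 0 <= cut_rearr f t s.
Proof. by rewrite /cut_rearr patchE; case: ifP => // _; exact: rearr_ge0. Qed.

Lemma int_cut_rearr f t : \int[@lebesgue_measure R]_s cut_rearr f t s = intrearr mu f t.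
Proof. by rewrite /intrearr [RHS]integral_mkcond. Qed.

(** By [lt_rearr] this level set is the part of ]0, t] with [s < distrib f y], an interval. Bounding
    an integral by [intrearr] thereby reduces to two bounds on level sets: by [t] and by
    [distrib f y]. *)
Lemma cut_rearr_level f t y : measurable_fun setT f -> (0 < t)%R -> (0 <= y)%R ->
  @lebesgue_measure R [set s | y%:E < cut_rearr f t s] = mine t%:E (distrib mu f y).
Proof.
move=> mf t0 y0.
have -> : [set s | y%:E < cut_rearr f t s] =
    [set s | (0 < s <= t)%R /\ s%:E < distrib mu f y].
  apply/seteqP; split => s /=; rewrite /cut_rearr patchE.
  - case: ifPn => [|_]; last by rewrite lte_fin ltNge y0.
    by rewrite inE/= in_itv/= lt_rearr.
  - by move=> [st sd]; rewrite mem_set/= ?in_itv// lt_rearr.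
have : 0 <= distrib mu f y by exact: measure_ge0.
case: (distrib mu f y) => [r| |//].
- rewrite lee_fin => r0; rewrite -EFin_min; have [tr|rt] := ltP t r.
  + have -> : [set s | (0 < s <= t)%R /\ s%:E < r%:E] = `]0%R, t]%classic.
      apply/seteqP; split => s /=; rewrite in_itv/= lte_fin; first by case.
      by move=> /andP[-> st]; rewrite st; split => //; exact: le_lt_trans tr.
    have := lebesgue_measure_itv `]0%R, t]; rewrite /= => ->.
    by rewrite lte_fin t0 oppr0 adde0.
  + have -> : [set s | (0 < s <= t)%R /\ s%:E < r%:E] = `]0%R, r[%classic.
      apply/seteqP; split => s /=; rewrite in_itv/= lte_fin.
      - by move=> [/andP[-> _] ->].
      - by move=> /andP[-> sr]; rewrite sr (le_trans (ltW sr)).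
    have := lebesgue_measure_itv `]0%R, r[; rewrite /= => ->.
    rewrite lte_fin oppr0 adde0; case: ltrP => // r0'.
    by congr EFin; apply/eqP; rewrite eq_le r0 r0'.
- move=> _; have -> : [set s | (0 < s <= t)%R /\ s%:E < +oo] = `]0%R, t]%classic.
    apply/seteqP; split => s /=; rewrite in_itv/= ltry; first by case.
    by move=> ->.
  have := lebesgue_measure_itv `]0%R, t]; rewrite /= => ->.
  by rewrite lte_fin t0 oppr0 adde0 minEle leey.
Qed.

Lemma integral_le_intrearr f A t : measurable_fun setT f -> measurable A ->
  (0 < t)%R -> mu A <= t%:E -> \int[mu]_(x in A) `|f x| <= intrearr mu f t.
Proof.
move=> mf mA t0 At; rewrite integral_mkcond -int_cut_rearr.
apply: le_integral_level_sets1.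
- apply/(measurable_restrictT _ mA); apply: measurable_funTS.
  exact: measurableT_comp.
- by move=> x; rewrite patchE; case: ifP.
- exact: measurable_cut_rearr.
- by move=> x; exact: cut_rearr_ge0.
move=> y y0; rewrite [X in _ <= X](cut_rearr_level mf t0 (ltW y0)).
have -> : [set x | y%:E < ((fun x => `|f x|) \_ A) x] = A `&` [set x | y%:E < `|f x|].
  apply/seteqP; split => x /=; rewrite patchE.
  - case: ifPn => [|_]; last by rewrite lte_fin ltNge (ltW y0).
    by rewrite inE.
  - by move=> [Ax yx]; rewrite mem_set.
have mD := measurable_distrib_set y mf.
rewrite le_min; apply/andP; split.
- by apply: le_trans At; apply: le_measure; rewrite ?inE//; exact: measurableI.
- by apply: le_measure; rewrite ?inE//; exact: measurableI.
Qed.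

(** Level [y] of the excess is level [y + a] of |f|. Its measure is at most [distrib f y], and at
    most [distrib f a], which is at most [t] because [a] dominates the rearrangement at [t]. *)
Lemma excess_le_intrearr f (a t : R) : measurable_fun setT f -> (0 < t)%R ->
  (0 <= a)%R -> rearr mu f t <= a%:E ->
  \int[mu]_x maxe (`|f x| - a%:E) 0 <= intrearr mu f t.
Proof.
move=> mf t0 a0 fa; rewrite -int_cut_rearr.
apply: le_integral_level_sets1.
- apply: measurable_maxe => //; apply: emeasurable_funB => //.
  exact: measurableT_comp.
- by move=> x; rewrite le_max lexx orbT.
- exact: measurable_cut_rearr.
- by move=> x; exact: cut_rearr_ge0.
move=> y y0; rewrite [X in _ <= X](cut_rearr_level mf t0 (ltW y0)).
have -> : [set x | y%:E < maxe (`|f x| - a%:E) 0] = [set x | (y + a)%:E < `|f x|].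
  apply/funext => x; apply/propext.
  rewrite /mkset lt_max lte_fin [X in _ || X]ltNge (ltW y0) orbF EFinD.
  by rewrite lteBrDr.
rewrite -/(distrib mu f (y + a)) le_min; apply/andP; split.
- apply: (@le_trans _ _ (distrib mu f a)).
    by apply: distrib_nonincreasing; rewrite // lerDr ltW.
  by rewrite leNgt -lt_rearr// -leNgt.
- by apply: distrib_nonincreasing; rewrite // lerDl.
Qed.

End hardy_littlewood.

(** * Measurability and weak-type bound of the fractional maximal function *)

Section fractional_maximal_function.
Local Open Scope ereal_scope.
Context (R : realType) (m : nat) (Phi : R -> R) (C : R).
Hypothesis Phi_le : forall r s, (0 < r)%R -> (r <= s)%R -> (Phi s <= Phi r)%R.
Hypothesis Phi_gt0 : forall r, (0 < r)%R -> (0 < Phi r)%R.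
Hypothesis Phi_cont : forall r, (0 < r)%R -> {for r, continuous Phi}.
Hypothesis C_gt0 : (0 < C)%R.
Hypothesis Phi_int : forall r : R, (0 < r)%R ->
  \int[@lebesgue_measure R]_(s in `]0%R, r[%classic) (Phi s * s ^+ m)%:E
    <= (C * Phi r * r ^+ m.+1)%:E.

Local Notation X := (ms_type (leb_space R m)).
Local Notation L := (@leb_sfinite R m).
Implicit Types (f g : Rn R m.+1 -> \bar R).

Lemma measurable_ball_n (x : Rn R m.+1) r : measurable (@ball_n R m.+1 x r).
Proof.
have := measurable_fun_ltr (measurable_fun_pair2 (x : X) (@measurable_sqdist R m))
  (@measurable_cst _ _ _ _ _ (r ^+ 2)%R).
by move=> /(_ measurableT [set true]); rewrite setTI; apply.
Qed.

Lemma ball_n_subset_cube (x : Rn R m.+1) r : (0 < r)%R ->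
  @ball_n R m.+1 x r `<=` [set y : X | (supdist (x : X) y < r)%R].
Proof.
move=> r0 y /=; rewrite /ball_n/= => xy.
have := le_lt_trans (supdist_sqr_le (x : X) y) xy.
by rewrite ltr_pXn2r// nnegrE ?supdist_ge0// ltW.
Qed.

Lemma ball_n_measure_le (x : Rn R m.+1) r : (0 < r)%R ->
  lebn R m.+1 (@ball_n R m.+1 x r) <= ((2 * r) ^+ m.+1)%:E.
Proof.
move=> r0; rewrite -(cube_measure (x : X) r0).
apply: le_measure; rewrite ?inE.
- exact: measurable_ball_n.
- exact: measurable_cube.
- exact: ball_n_subset_cube.
Qed.

Lemma measurable_ball_integral f r : measurable_fun setT f ->
  measurable_fun setT (fun x : Rn R m.+1 =>
    \int[lebn R m.+1]_(y in ball_n x r) `|f y|).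
Proof.
move=> mf; pose B := [set z : X * X | (sqdist z.1 z.2 < r ^+ 2)%R].
have mB : measurable B.
  have := measurable_fun_ltr (@measurable_sqdist R m)
    (@measurable_cst _ _ _ _ _ (r ^+ 2)%R).
  by move=> /(_ measurableT [set true]); rewrite setTI; apply.
pose K (z : X * X) : \bar R := `|f z.2| * (\1_B z)%:E.
have mK : measurable_fun setT K.
  apply: emeasurable_funM.
  - apply: measurableT_comp => //; exact: measurableT_comp mf measurable_snd.
  - by apply/measurable_EFinP; exact: measurable_indic.
have K0 z : 0 <= K z by rewrite /K mule_ge0// lee_fin.
have := @measurable_fun_fubini_tonelli_F _ _ _ _ _ L K mK K0.
rewrite /fubini_F; congr measurable_fun; apply/funext => x.
rewrite [RHS]integral_mkcond; apply: eq_integral => y _; rewrite /K patchE indicE/=.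
rewrite (_ : ((x, y) \in B) = (y \in @ball_n R m.+1 x r)); last by apply/idP/idP; rewrite !inE.
by case: ifP => _; rewrite ?mule1 ?mule0.
Qed.

(** Rational radii suffice, which makes M_Phi f measurable: enlarging a good radius slightly does
    not decrease the ball integral, and continuity of Phi keeps the product above [y]. *)
Lemma frac_max_gtP f x (y : R) : measurable_fun setT f ->
  y%:E < frac_max Phi f x <-> exists2 q : rat, (0 < ratr q :> R)%R &
    y%:E < (Phi (ratr q))%:E * \int[lebn R m.+1]_(y in ball_n x (ratr q)) `|f y|.
Proof.
move=> mf; split; last first.
  move=> [q q0 yq]; apply: (lt_le_trans yq); apply: ereal_sup_ubound.
  by exists (ratr q : R).
move=> /ereal_sup_gt[_ [r /= r0 <-] yr].
set I := \int[_]_(_ in _) _ in yr.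
have I0 : 0 <= I by exact: integral_ge0.
have [e e0 He] : exists2 e : R, (0 < e)%R &
    forall q, (r < q < r + e)%R -> y%:E < (Phi q)%:E * I.
  case: I I0 yr => [i| |//].
  - rewrite lee_fin -EFinM lte_fin => i0 yi.
    have : (fun q => Phi q * i)%R @ r --> (Phi r * i)%R.
      by apply: cvgMl; exact: Phi_cont.
    move=> /cvgr_gt/(_ _ yi)/nbhs_ballP[e /= e0 He]; exists e => //.
    move=> q /andP[rq qe]; rewrite -EFinM lte_fin; apply: He.
    by rewrite /ball/= ltr_distlC; lra.
  - move=> _ _; exists 1%R => // q /andP[rq _].
    by rewrite gt0_muley ?ltry// lte_fin Phi_gt0// (lt_trans r0).
have re : (r < r + e)%R by rewrite ltrDl.
have [q] := rat_in_itvoo re.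
rewrite in_itv/= => rq.
have rq' : (r < ratr q :> R)%R by case/andP: rq.
exists q; first exact: lt_trans rq'.
apply: (lt_le_trans (He _ rq)); apply: lee_wpmul2l.
  by rewrite lee_fin ltW// Phi_gt0// (lt_trans r0).
apply: ge0_subset_integral.
- exact: measurable_ball_n.
- exact: measurable_ball_n.
- by apply: measurable_funTS; exact: measurableT_comp.
- by [].
- move=> z; rewrite /ball_n/= => /lt_trans; apply.
  by rewrite ltr_pXn2r// nnegrE ltW// (lt_trans r0).
Qed.

Lemma measurable_frac_max f : measurable_fun setT f ->
  measurable_fun setT (frac_max Phi f).
Proof.
move=> mf; apply: measurable_fun_gt_sets => // y; rewrite setTI.
pose S (q : rat) : set (Rn R m.+1) := if (0 < ratr q :> R)%R then
  [set x | y%:E < (Phi (ratr q))%:E * \int[lebn R m.+1]_(y in ball_n x (ratr q)) `|f y|]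
  else set0.
have -> : [set x | y%:E < frac_max Phi f x] = \bigcup_q S q.
  apply/seteqP; split => x /=.
  - move=> /(frac_max_gtP _ _ mf)[q q0 yq]; exists q => //.
    by rewrite /S q0.
  - move=> [q _]; rewrite /S; case: ifPn => // q0 yq.
    by apply/(frac_max_gtP _ _ mf); exists q.
apply: bigcupT_measurable_rat => q; rewrite /S; case: ifPn => // q0.
apply: measurable_gt_set; apply: measurable_funeM.
exact: measurable_ball_integral.
Qed.

Lemma frac_max_ge f x r : (0 < r)%R ->
  (Phi r)%:E * \int[lebn R m.+1]_(y in ball_n x r) `|f y| <= frac_max Phi f x.
Proof. by move=> r0; apply: ereal_sup_ubound; exists r. Qed.

Lemma frac_max_ge0 f x : 0 <= frac_max Phi f x.
Proof.
apply: le_trans (frac_max_ge f x ltr01).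
by rewrite mule_ge0 ?integral_ge0// lee_fin ltW// Phi_gt0.
Qed.

Lemma measurable_wt_dist : measurable_fun setT
  (fun z : X * X => wt Phi (supdist z.1 z.2)).
Proof.
exact: (measurableT_comp (measurable_wt Phi_le) (@measurable_supdist R m)).
Qed.

(** A Euclidean ball of radius [r] lies in the cube of half side [r], where the decreasing weight is
    at least [Phi r]; the resulting kernel no longer depends on [r]. *)
Lemma frac_max_le_potential f (x : X) : measurable_fun setT f ->
  frac_max Phi f x <= \int[L]_y (wt Phi (supdist x y) * `|f y|).
Proof.
move=> mf; apply: ge_ereal_sup => _ [r /= r0 <-].
have Pr : (0 <= Phi r)%R by rewrite ltW// Phi_gt0.
rewrite -ge0_integralZl_EFin//; last 2 first.
- exact: measurable_ball_n.
- by apply: measurable_funTS; exact: measurableT_comp.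
have mp : measurable_fun setT (fun y : X => wt Phi (supdist x y) * `|f y|).
  apply: emeasurable_funM; last exact: measurableT_comp.
  exact: (measurable_fun_pair2 x measurable_wt_dist).
have p0 y : 0 <= wt Phi (supdist x y) * `|f y| by rewrite mule_ge0// wt_ge0.
apply: (@le_trans _ _ (\int[L]_(y in @ball_n R m.+1 x r) (wt Phi (supdist x y) * `|f y|))).
  apply: ge0_le_integral.
  - exact: measurable_ball_n.
  - by move=> y _; rewrite mule_ge0.
  - apply: measurable_funTS; apply: measurable_funeM; exact: measurableT_comp.
  - exact: measurable_funTS.
  - move=> y /(ball_n_subset_cube r0)/= xy; apply: lee_wpmul2r => //.
    have := wt_nonincreasing Phi_le (ltW xy); apply: le_trans.
    by rewrite /wt r0.
apply: ge0_subset_integral => //; exact: measurable_ball_n.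
Qed.

(** The weak-type argument cancels [L A], so it needs a subset of finite measure still exceeding
    [s]. *)
Lemma cubes_exhaust (A : set X) (s : R) : measurable A -> s%:E < L A ->
  exists A', [/\ measurable A', A' `<=` A, s%:E < L A' & L A' < +oo].
Proof.
move=> mA sA; pose Q k := [set y : X | (supdist (@origin R m) y < k.+1%:R)%R].
have mQ k : measurable (A `&` Q k) by apply: measurableI => //; exact: measurable_cube.
have AQ : A = \bigcup_k (A `&` Q k).
  apply/seteqP; split => x; last by move=> [k _] [].
  by move=> Ax; exists (Num.truncn (supdist (@origin R m) x)) => //; split => //; exact: truncnS_gt.
have ndQ : {homo (fun k => A `&` Q k) : n k / (n <= k)%N >-> (n <= k)%O}.
  move=> n k nk; apply/subsetPset; apply: setIS => x /= /lt_le_trans; apply.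
  by rewrite ler_nat ltnS.
have cQ := nondecreasing_cvg_mu (mu := L) mQ (bigcupT_measurable _ mQ) ndQ.
have [k sk] : exists k, s%:E < L (A `&` Q k).
  apply: contrapT => /forallNP H; move: sA; apply/negP; rewrite -leNgt.
  rewrite [X in L X]AQ -(cvg_lim _ cQ)//; apply: lime_le.
    by apply/cvg_ex; eexists; exact: cQ.
  by apply: nearW => k /=; rewrite leNgt; apply/negP; exact: H.
exists (A `&` Q k); split => //.
apply: (@le_lt_trans _ _ (L (Q k))).
  by apply: le_measure; rewrite ?inE//; exact: measurable_cube.
by rewrite [L _]cube_measure ?ltry// ltr0Sn.
Qed.

(** Tonelli lets the potential kernel be integrated over [A] in [x] first. [radial_integral_set]
    bounds that integral uniformly in [y], and only the integral of |g| is left. *)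
Lemma integral_frac_max_le g (A : set X) (s F : R) : measurable_fun setT g ->
  measurable A -> (0 < s)%R -> s%:E <= L A ->
  \int[L]_y `|g y| <= F%:E -> (0 <= F)%R ->
  \int[L]_(x in A) frac_max Phi g x <=
    ((8 ^+ m.+1 * C + 1) * Phi (nroot m s) * F)%:E * L A.
Proof.
move=> mg mA s0 sA gF F0.
pose c := ((8 ^+ m.+1 * C + 1) * Phi (nroot m s))%R.
have c0 : (0 <= c)%R.
  by rewrite mulr_ge0 ?addr_ge0 ?mulr_ge0 ?exprn_ge0 ?(ltW C_gt0) ?ltW ?Phi_gt0 ?nroot_gt0.
pose K (z : X * X) : \bar R := wt Phi (supdist z.1 z.2) * `|g z.2| * (\1_A z.1)%:E.
have mA1 : measurable_fun setT (fun z : X * X => (\1_A z.1 : R)%:E).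
  apply/measurable_EFinP.
  have mi : measurable_fun setT (\1_A : X -> R) by exact: measurable_indic.
  exact: (measurableT_comp mi (@measurable_fst _ _ X X)).
have mK : measurable_fun setT K.
  apply: emeasurable_funM => //; apply: emeasurable_funM.
  - exact: measurable_wt_dist.
  - apply: measurableT_comp => //; exact: measurableT_comp mg measurable_snd.
have w0 r : 0 <= wt Phi r by exact: wt_ge0.
have K0 z : 0 <= K z by rewrite /K !mule_ge0// lee_fin.
apply: (@le_trans _ _ (\int[L]_x \int[L]_y K (x, y))).
  rewrite integral_mkcond; apply: ge0_le_integral => //.
  - by move=> x _; rewrite patchE; case: ifP => // _; exact: frac_max_ge0.
  - apply/(measurable_restrictT _ mA); apply: measurable_funTS.
    exact: measurable_frac_max.
  - exact: (measurable_fun_fubini_tonelli_F K mK K0).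
  - move=> x _; rewrite patchE; case: ifPn => xA; last exact: integral_ge0.
    apply: (le_trans (frac_max_le_potential x mg)).
    rewrite le_eqVlt; apply/orP; left; apply/eqP; apply: eq_integral => y _.
    by rewrite /K/= indicE xA mule1.
rewrite (fubini_tonelli K mK K0).
apply: (@le_trans _ _ (\int[L]_y (`|g y| * (c%:E * L A)))).
  apply: ge0_le_integral => //.
  - by move=> y _; exact: integral_ge0.
  - exact: (measurable_fun_fubini_tonelli_G K mK K0).
  - apply: emeasurable_funM => //; exact: measurableT_comp.
  - move=> y _.
    have mw : measurable_fun setT (fun x : X => supdist x y).
      exact: (measurable_fun_pair1 y (@measurable_supdist R m)).
    have Lw r : (0 < r)%R -> L [set x | (supdist x y < r)%R] <= ((2 * r) ^+ m.+1)%:E.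
      move=> r0; rewrite -(cube_measure y r0); under eq_set do rewrite supdistC.
      exact: lexx.
    have := radial_integral_set Phi_le Phi_gt0 C_gt0 Phi_int mw Lw s0 mA sA.
    rewrite -/c => H.
    apply: (le_trans _ (lee_wpmul2l (abse_ge0 (g y)) H)).
    rewrite -ge0_integralZl//; last first.
      exact: measurable_funTS (measurableT_comp (measurable_wt Phi_le) mw).
    rewrite [leRHS]integral_mkcond le_eqVlt; apply/orP; left; apply/eqP.
    apply: eq_integral => x _; rewrite /K/= patchE indicE; case: ifP => _.
    - by rewrite mule1 muleC.
    - by rewrite mule0.
have cA0 : 0 <= c%:E * L A by rewrite mule_ge0.
rewrite ge0_integralZr//; last exact: measurableT_comp.
rewrite -/c (_ : (c * F)%:E * L A = F%:E * (c%:E * L A)); first by rewrite lee_wpmul2r.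
by rewrite mulrC EFinM muleA.
Qed.

(** If the set {M_Phi g > b} had measure above [s], the mean of M_Phi g over a finite part [A] of it
    would be at least [b], whereas [integral_frac_max_le] puts it strictly below [b]. *)
Lemma frac_max_weak_type g (s F b : R) : measurable_fun setT g ->
  (0 < s)%R -> \int[L]_y `|g y| <= F%:E -> (0 <= F)%R ->
  ((8 ^+ m.+1 * C + 1) * Phi (nroot m s) * F < b)%R ->
  L [set x | b%:E < frac_max Phi g x] <= s%:E.
Proof.
move=> mg s0 gF F0 cb; rewrite leNgt; apply/negP => sL.
have mM := measurable_frac_max mg.
have mS : measurable [set x : X | b%:E < frac_max Phi g x] by exact: measurable_gt_set.
have [A [mA AS sA Aoo]] := cubes_exhaust mS sL.
have := integral_frac_max_le mg mA s0 (ltW sA) gF F0.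
apply/negP; rewrite -ltNge.
have Afin : L A \is a fin_num by rewrite ge0_fin_numE.
have A0 : 0 < L A by apply: lt_trans sA; rewrite lte_fin.
apply: (@lt_le_trans _ _ (b%:E * L A)).
  by rewrite lte_pmul2r// lte_fin.
rewrite -integral_cst//; apply: ge0_le_integral => //.
- move=> x _; rewrite lee_fin ltW//; apply: le_lt_trans cb.
  rewrite mulr_ge0// mulr_ge0 ?addr_ge0 ?mulr_ge0 ?exprn_ge0 ?(ltW C_gt0)//.
  by rewrite ltW// Phi_gt0// nroot_gt0.
- exact: measurable_funTS.
- by move=> x /AS/ltW.
Qed.

End fractional_maximal_function.

(** * Upper bound of the rearranged maximal function by the K3 functional *)

Section upper_bound.
Local Open Scope ereal_scope.
Context (R : realType) (m : nat) (Phi : R -> R) (C : R).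
Hypothesis Phi_le : forall r s, (0 < r)%R -> (r <= s)%R -> (Phi s <= Phi r)%R.
Hypothesis Phi_gt0 : forall r, (0 < r)%R -> (0 < Phi r)%R.
Hypothesis Phi_cont : forall r, (0 < r)%R -> {for r, continuous Phi}.
Hypothesis C_gt0 : (0 < C)%R.
Hypothesis Phi_int : forall r : R, (0 < r)%R ->
  \int[@lebesgue_measure R]_(s in `]0%R, r[%classic) (Phi s * s ^+ m)%:E
    <= (C * Phi r * r ^+ m.+1)%:E.

Local Notation X := (ms_type (leb_space R m)).
Local Notation L := (@leb_sfinite R m).
Local Notation phi t := (Phi (nroot m t)).
Local Notation KF := (@K3fun R m.+1 Phi).
Local Notation F := (intrearr (lebn R m.+1)).
Implicit Types (f g : Rn R m.+1 -> \bar R).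

Lemma phi_gt0 t : (0 < t)%R -> (0 < phi t)%R.
Proof. by move=> t0; rewrite Phi_gt0// nroot_gt0. Qed.

Lemma K3fun_termE f t : (0 < t)%R ->
  (t * phi t)%:E * rearr2 (lebn R m.+1) f t = (phi t)%:E * F f t.
Proof. by move=> t0; rewrite intrearrE// [(t * _)%R]mulrC EFinM -muleA. Qed.

Lemma K3fun_ge f t u : (0 < t)%R -> (t < u)%R -> (phi u)%:E * F f u <= KF f t.
Proof.
move=> t0 tu; apply: ereal_sup_ubound; exists u => //.
exact: (K3fun_termE f (lt_trans t0 tu)).
Qed.

Lemma K3fun_ge0 f t : (0 < t)%R -> 0 <= KF f t.
Proof.
move=> t0; have tt : (t < 2 * t)%R by rewrite ltr_pMl// ltr1n.
apply: le_trans (K3fun_ge f t0 tt); rewrite mule_ge0 ?intrearr_ge0// lee_fin.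
by rewrite ltW// phi_gt0// (lt_trans t0).
Qed.

Local Notation c2 := (4 ^+ m.+1 * C)%R.

Lemma Phi_le_double r : (0 < r)%R -> (Phi r <= c2 * Phi (2 * r))%R.
Proof.
move=> r0; have := Phi_doubling Phi_le Phi_gt0 Phi_int r0 (ler1n R 2).
by rewrite (_ : (2 * 2%:R = 4 :> R)%R)//; ring.
Qed.

Lemma c2_gt0 : (0 < c2)%R. Proof. by rewrite mulr_gt0// exprn_gt0. Qed.

(** The supremum in [K3fun] excludes tau = t. Passing to 2^n t doubles the root, and doubling of Phi
    costs [c2]. *)
Lemma phi_intrearr_le f t : (0 < t)%R -> (phi t)%:E * F f t <= c2%:E * KF f t.
Proof.
move=> t0; pose u := (2 ^+ m.+1 * t)%R.
have tu : (t < u)%R by rewrite ltr_pMl// exprn_egt1// ltr1n.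
have ru : (nroot m u = 2 * nroot m t)%R.
  by rewrite /u -[X in (_ * X)%R](nrootK m (ltW t0)) -exprMn nroot_exp// mulr_ge0 ?nroot_ge0.
apply: (le_trans _ (lee_wpmul2l _ (K3fun_ge f t0 tu))); last by rewrite lee_fin ltW// c2_gt0.
rewrite muleA -EFinM ru; apply: lee_pmul => //.
- by rewrite lee_fin ltW// phi_gt0.
- exact: intrearr_ge0.
- by rewrite lee_fin Phi_le_double// nroot_gt0.
- by apply: intrearr_nondecreasing; exact: ltW.
Qed.

(** Small balls use the bound [a] on the integrand, large balls the Hardy-Littlewood bound. The two
    cases give [c2 * c2] and [c2], both below [c2 * (c2 + 1)]. *)
Lemma frac_max_truncated_le f (a t r : R) (x : Rn R m.+1) : measurable_fun setT f ->
  (0 < t)%R -> (0 <= a)%R -> rearr (lebn R m.+1) f t = a%:E -> (0 < r)%R ->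
  (Phi r)%:E * \int[L]_(y in @ball_n R m.+1 x r) mine `|f y| a%:E
    <= (c2 * (c2 + 1))%:E * KF f t.
Proof.
move=> mf t0 a0 fa r0.
have K0 := K3fun_ge0 f t0.
have Pr : (0 <= Phi r)%R by rewrite ltW// Phi_gt0.
have mB := @measurable_ball_n R m x r.
have mf' : measurable_fun setT (fun y => `|f y|) by exact: measurableT_comp.
have c20 := c2_gt0.
have [rt|tr] := leP ((2 * r) ^+ m.+1)%R t.
(* Volume at most [t]: quasi-monotonicity of Phi(r) r^n replaces the radius by [nroot m t], and
   [t * a] is at most the integral of the rearrangement up to [t]. *)
- apply: (@le_trans _ _ ((c2 * c2)%:E * KF f t)); last first.
    by rewrite lee_wpmul2r// lee_fin ler_wpM2l ?(ltW c20)// lerDl.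
  rewrite EFinM -muleA.
  apply: (le_trans _ (lee_wpmul2l _ (phi_intrearr_le f t0))); last by rewrite lee_fin ltW.
  apply: (@le_trans _ _ ((Phi r)%:E * (a%:E * ((2 * r) ^+ m.+1)%:E))).
    apply: lee_wpmul2l; first by rewrite lee_fin.
    apply: (@le_trans _ _ (a%:E * L (@ball_n R m.+1 x r))).
      rewrite -integral_cst//; apply: ge0_le_integral => //.
      - by move=> y _; rewrite le_min abse_ge0 lee_fin.
      - by apply: measurable_funTS; exact: measurable_mine.
      - by move=> y _; rewrite ge_min lexx orbT.
    by apply: lee_wpmul2l; [rewrite lee_fin|exact: ball_n_measure_le].
  apply: (@le_trans _ _ (c2%:E * ((phi t)%:E * (t%:E * a%:E)))); last first.
    apply: lee_wpmul2l; first by rewrite lee_fin ltW.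
    apply: lee_wpmul2l; first by rewrite lee_fin ltW// phi_gt0.
    by rewrite -fa; exact: rearr_le_intrearr.
  have rr : (r <= nroot m t)%R.
    rewrite leNgt lt_nroot ?(ltW t0) ?(ltW r0)// -leNgt; apply: le_trans rt.
    by rewrite exprMn ler_peMl ?exprn_ge0 ?(ltW r0)// exprn_ege1// ler1n.
  rewrite -!EFinM lee_fin.
  have := Phi_pow_quasi_increasing Phi_le Phi_gt0 Phi_int r0 rr.
  rewrite nrootK ?(ltW t0)// => H.
  have := ler_wpM2l (mulr_ge0 a0 (exprn_ge0 m.+1 (ler0n R 2))) H.
  rewrite (_ : (Phi r * (a * _) = a * 2 ^+ m.+1 * (Phi r * r ^+ m.+1))%R); last first.
    by rewrite exprMn; ring.
  move/le_trans; apply; rewrite le_eqVlt; apply/orP; left; apply/eqP.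
  rewrite (_ : (4 ^+ m.+1 = 2 ^+ m.+1 * 2 ^+ m.+1 :> R)%R); first by ring.
  by rewrite -exprMn -natrM.
(* Volume bound (2r)^n above [t]: this value is itself an admissible tau, with root [2 * r]. *)
- apply: (@le_trans _ _ (c2%:E * KF f t)); last first.
    by rewrite lee_wpmul2r// lee_fin ler_peMr ?(ltW c20)// lerDr ltW.
  apply: (le_trans _ (lee_wpmul2l _ (K3fun_ge f t0 tr))); last by rewrite lee_fin ltW.
  rewrite nroot_exp ?mulr_ge0 ?(ltW r0)// muleA -EFinM; apply: lee_pmul.
  - by rewrite lee_fin.
  - by apply: integral_ge0 => y _; rewrite le_min abse_ge0 lee_fin.
  - by rewrite lee_fin Phi_le_double.
  apply: (@le_trans _ _ (\int[L]_(y in @ball_n R m.+1 x r) `|f y|)).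
    apply: ge0_le_integral => //.
    - by move=> y _; rewrite le_min abse_ge0 lee_fin.
    - by apply: measurable_funTS; exact: measurable_mine.
    - exact: measurable_funTS.
    - by move=> y _; rewrite ge_min lexx.
  apply: (@integral_le_intrearr R _ _ L) => //.
    by rewrite exprn_gt0// mulr_gt0.
  exact: ball_n_measure_le.
Qed.

Lemma frac_max_split_le f (a t : R) (x : Rn R m.+1) : measurable_fun setT f ->
  (0 < t)%R -> (0 <= a)%R -> rearr (lebn R m.+1) f t = a%:E ->
  frac_max Phi f x <= frac_max Phi (fun y => maxe (`|f y| - a%:E) 0) x
    + (c2 * (c2 + 1))%:E * KF f t.
Proof.
move=> mf t0 a0 fa; apply: ge_ereal_sup => _ [r /= r0 <-].
have mf' : measurable_fun setT (fun y => `|f y|) by exact: measurableT_comp.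
have mB := @measurable_ball_n R m x r.
have m1 : measurable_fun setT (fun y => maxe (`|f y| - a%:E) 0).
  by apply: measurable_maxe => //; exact: emeasurable_funB.
have g1 y : 0 <= maxe (`|f y| - a%:E) 0 by rewrite le_max lexx orbT.
apply: (le_trans _ (leeD (frac_max_ge _ _ _ r0) (frac_max_truncated_le x mf t0 a0 fa r0))).
rewrite -ge0_muleDr; last 2 first.
- by apply: integral_ge0.
- by apply: integral_ge0 => y _; rewrite le_min abse_ge0 lee_fin.
apply: lee_wpmul2l; first by rewrite lee_fin ltW// Phi_gt0.
under [X in _ <= X + _]eq_integral do rewrite gee0_abs//.
rewrite -(@ge0_integralD _ _ _ L)//; last 3 first.
- exact: measurable_funTS.
- by move=> y _; rewrite le_min abse_ge0 lee_fin.
- by apply: measurable_funTS; exact: measurable_mine.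
apply: ge0_le_integral => //.
- exact: measurable_funTS.
- by apply: measurable_funTS; apply: emeasurable_funD => //; exact: measurable_mine.
move=> y _; have := abse_ge0 (f y); case: `|f y| => [v| |]//.
rewrite lee_fin => v0; rewrite -EFinB -EFin_max -EFin_min -EFinD lee_fin.
by rewrite maxEle minEle; case: ifPn; case: ifPn; rewrite -?ltNge; lra.
Qed.

(** After the cut at the height [rearr f t], the bounded part only shifts the level by a constant,
    and the weak-type bound at [s] is applied to the excess. If either term on the right is infinite
    there is nothing to prove; otherwise that height is finite. *)
Lemma rearr_frac_max_le f s t : measurable_fun setT f -> (0 < s)%R -> (0 < t)%R ->
  rearr (lebn R m.+1) (frac_max Phi f) s <=
  ((8 ^+ m.+1 * C + 1) * phi s)%:E * F f t + (c2 * (c2 + 1))%:E * KF f t.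
Proof.
move=> mf s0 t0; set K := (8 ^+ m.+1 * C + 1)%R; set D := (c2 * (c2 + 1))%R.
have K0 : (0 < K)%R by rewrite addr_gt0// mulr_gt0// exprn_gt0.
have D0 : (0 < D)%R by rewrite mulr_gt0 ?addr_gt0 ?c2_gt0.
have Kp0 : (0 < K * phi s)%R by rewrite mulr_gt0// phi_gt0.
have F0 : 0 <= F f t by exact: intrearr_ge0.
have T0 : 0 <= KF f t by exact: K3fun_ge0.
have [Foo|Ffin] := eqVneq (F f t) +oo.
  by rewrite Foo gt0_muley ?lte_fin// addye ?leey// gt_eqF// (lt_le_trans ltNy0)// mule_ge0// lee_fin ltW.
have [Too|Tfin] := eqVneq (KF f t) +oo.
  rewrite Too gt0_muley ?lte_fin// addey ?leey// gt_eqF// (lt_le_trans ltNy0)//.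
  by rewrite mule_ge0// lee_fin ltW.
have Fn : F f t \is a fin_num by rewrite ge0_fin_numE// ltey.
have Tn : KF f t \is a fin_num by rewrite ge0_fin_numE// ltey.
have an : rearr (lebn R m.+1) f t \is a fin_num.
  rewrite ge0_fin_numE ?rearr_ge0// ltey; apply/eqP => E.
  have := rearr_le_intrearr (lebn R m.+1) f t0; rewrite E gt0_muley ?lte_fin//.
  by rewrite leye_eq (negbTE Ffin).
rewrite -(fineK Fn) -(fineK Tn) -!EFinM -EFinD.
set v := fine (F f t); set k := fine (KF f t).
have v0 : (0 <= v)%R by exact: fine_ge0.
have k0 : (0 <= k)%R by exact: fine_ge0.
apply: le_rearr_of_distrib; first by rewrite addr_ge0// mulr_ge0// ltW.
move=> y by_; set a := fine (rearr (lebn R m.+1) f t).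
have fa : rearr (lebn R m.+1) f t = a%:E by rewrite fineK.
have a0 : (0 <= a)%R by rewrite fine_ge0// rearr_ge0.
pose f1 y := maxe (`|f y| - a%:E) 0.
have m1 : measurable_fun setT f1.
  apply: measurable_maxe => //; apply: emeasurable_funB => //; exact: measurableT_comp.
have g1 z : 0 <= f1 z by rewrite le_max lexx orbT.
(* The level left for the excess once the contribution [D * k] of the bounded part is removed. *)
have b1 : (K * phi s * v < y - D * k)%R by rewrite ltrBrDr.
have f1v : \int[L]_z `|f1 z| <= v%:E.
  under eq_integral do rewrite gee0_abs//.
  rewrite fineK//; apply: (@excess_le_intrearr R _ _ L) => //.
  by rewrite -[X in _ <= X]fa.
have := frac_max_weak_type Phi_le Phi_gt0 Phi_cont C_gt0 Phi_int m1 s0 f1v v0 b1.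
apply: le_trans; apply: le_measure; rewrite ?inE.
- apply: measurable_distrib_set; exact: (measurable_frac_max Phi_gt0 Phi_cont mf).
- apply: measurable_gt_set; exact: (measurable_frac_max Phi_gt0 Phi_cont m1).
move=> x /=; rewrite gee0_abs ?frac_max_ge0// => /lt_le_trans.
move/(_ _ (frac_max_split_le x mf t0 a0 fa)).
by rewrite -(fineK Tn) -EFinM -lteBlDr.
Qed.

(** Average of [rearr_frac_max_le] over [s] in ]0, t]. In the constant, [K] is the weak-type factor,
    [B] comes from integrating phi near 0, [c2] from including tau = t in the supremum, and [D] from
    the bounded part. *)
Lemma rearr2_frac_max_le f t : measurable_fun setT f -> (0 < t)%R ->
  rearr2 (lebn R m.+1) (frac_max Phi f) t <=
  ((8 ^+ m.+1 * C + 1) * (16 ^+ m.+1 * C) * c2 + c2 * (c2 + 1))%:E * KF f t.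
Proof.
move=> mf t0; set K := (8 ^+ m.+1 * C + 1)%R; set D := (c2 * (c2 + 1))%R.
set B := (16 ^+ m.+1 * C)%R.
have K0 : (0 < K)%R by rewrite addr_gt0// mulr_gt0// exprn_gt0.
have B0 : (0 < B)%R by rewrite mulr_gt0// exprn_gt0.
have D0 : (0 < D)%R by rewrite mulr_gt0 ?addr_gt0 ?c2_gt0.
have KB0 : (0 <= K * B * c2)%R.
  by rewrite mulr_ge0 ?(ltW c2_gt0)// mulr_ge0 ?(ltW K0) ?(ltW B0).
have F0 : 0 <= F f t by exact: intrearr_ge0.
have T0 : 0 <= KF f t by exact: K3fun_ge0.
have mphi : measurable_fun `]0%R, t]%classic (fun s : measurableTypeR R => (phi s)%:E).
  apply: (eq_measurable_fun (wt Phi \o nroot m)).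
    move=> s; rewrite inE/= in_itv/= => /andP[s0 _].
    by rewrite /wt nroot_gt0.
  apply: measurable_funTS; exact: measurableT_comp (measurable_wt Phi_le) (@measurable_nroot R m).
have p0 s : `]0%R, t]%classic s -> 0 <= (phi s)%:E.
  by rewrite /= in_itv/= => /andP[s0 _]; rewrite lee_fin ltW// phi_gt0.
rewrite /rearr2 lee_pdivrMl//.
apply: (@le_trans _ _ (\int[@lebesgue_measure R]_(s in `]0%R, t]%classic)
   ((K%:E * F f t) * (phi s)%:E + D%:E * KF f t))).
  apply: ge0_le_integral => //.
  - by move=> s _; exact: rearr_ge0.
  - exact: measurable_rearr.
  - by apply: emeasurable_funD => //; exact: measurable_funeM.
  - move=> s /=; rewrite in_itv/= => /andP[s0 _].
    by apply: (le_trans (rearr_frac_max_le mf s0 t0)); rewrite EFinM muleAC.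
rewrite ge0_integralD//; last 3 first.
- by move=> s /p0 ps; rewrite !mule_ge0// lee_fin ltW.
- exact: measurable_funeM.
- by move=> s _; rewrite mule_ge0// lee_fin ltW.
rewrite ge0_integralZl//; last by rewrite mule_ge0// lee_fin ltW.
rewrite integral_cst//.
have := lebesgue_measure_itv `]0%R, t]; rewrite /= lte_fin t0 oppr0 adde0 => ->.
rewrite (EFinD (K * B * c2) D) [in leRHS]ge0_muleDl; last 2 first.
- by rewrite lee_fin.
- by rewrite lee_fin ltW.
rewrite [in leRHS]ge0_muleDr; last 2 first.
- by rewrite mule_ge0// lee_fin.
- by rewrite mule_ge0// lee_fin ltW.
apply: leeD; last by rewrite muleC.
apply: (@le_trans _ _ (K%:E * F f t * (B * (phi t * t))%:E)).
  apply: lee_wpmul2l; first by rewrite mule_ge0// lee_fin ltW.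
  exact: int_Phi_nroot.
apply: (@le_trans _ _ ((K * B * t)%:E * ((phi t)%:E * F f t))).
  rewrite le_eqVlt; apply/orP; left; apply/eqP.
  by rewrite muleAC -EFinM [RHS]muleA -EFinM; congr (_%:E * _); ring.
apply: (@le_trans _ _ ((K * B * t)%:E * (c2%:E * KF f t))).
  apply: lee_wpmul2l; last exact: phi_intrearr_le.
  by rewrite lee_fin mulr_ge0 ?(ltW t0)// mulr_ge0 ?(ltW K0) ?(ltW B0).
rewrite le_eqVlt; apply/orP; left; apply/eqP.
by rewrite !muleA -!EFinM; congr (_%:E * _); ring.
Qed.

End upper_bound.

(** * Lower bound through symmetrization *)

Section lower_bound.
Local Open Scope ereal_scope.
Context (R : realType) (m : nat).
Local Notation X := (ms_type (leb_space R m)).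
Local Notation L := (@leb_sfinite R m).
Local Notation F := (intrearr (lebn R m.+1)).
Implicit Types (u : Rn R m.+1 -> \bar R).

(* Volume of the cube centred at the origin with x on its boundary: its
   distribution is the Lebesgue measure on [0, +oo[. *)
Definition supvol (x : X) : R := ((2 * supdist (@origin R m) x) ^+ m.+1)%R.

Lemma measurable_supvol : measurable_fun setT supvol.
Proof.
apply: measurable_funX; apply: measurable_funM => //.
exact: (measurable_fun_pair2 (@origin R m) (@measurable_supdist R m)).
Qed.

Lemma supvol_ge0 x : (0 <= supvol x)%R.
Proof. by rewrite exprn_ge0// mulr_ge0// supdist_ge0. Qed.

Lemma supvol_lt x t : (0 < t)%R ->
  (supvol x < t)%R = (supdist (@origin R m) x < nroot m t / 2)%R.
Proof.
move=> t0; rewrite ltr_pdivlMr// [(supdist _ _ * 2)%R]mulrC.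
by rewrite -[in LHS](nrootK m (ltW t0)) ltr_pXn2r// nnegrE ?nroot_ge0// mulr_ge0// supdist_ge0.
Qed.

Lemma supvol_measure_fin t : (0 <= t)%R -> L [set x | (supvol x < t)%R] = t%:E.
Proof.
rewrite le_eqVlt => /predU1P[<-|t0].
  have -> : [set x | (supvol x < 0)%R] = set0; last exact: measure0.
  by apply/seteqP; split => x //=; rewrite ltNge supvol_ge0.
have -> : [set x | (supvol x < t)%R] = [set x | (supdist (@origin R m) x < nroot m t / 2)%R].
  by apply/seteqP; split => x /=; rewrite supvol_lt.
have := cube_measure (@origin R m) (divr_gt0 (nroot_gt0 m t0) (ltr0n R 2)).
rewrite (_ : (2 * (nroot m t / 2%:R) = nroot m t)%R); last by field.
by rewrite nrootK// ltW.
Qed.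

Lemma measurable_supvol_lt (a : \bar R) : measurable [set x | (supvol x)%:E < a].
Proof.
rewrite -[X in measurable X]setTI; apply: emeasurable_fun_infty_o => //.
exact/measurable_EFinP/measurable_supvol.
Qed.

Lemma supvol_measure (a : \bar R) : 0 <= a -> L [set x | (supvol x)%:E < a] = a.
Proof.
case: a => [t| _|//]; first by rewrite lee_fin => t0; exact: supvol_measure_fin.
apply/eqP; rewrite -leye_eq; apply: (@le_by_pos_reals R) => // y y0 _.
rewrite -(supvol_measure_fin (ltW y0)); apply: le_measure; rewrite ?inE.
- exact: (measurable_supvol_lt y%:E).
- exact: measurable_supvol_lt.
- by move=> x _ /=; rewrite ltry.
Qed.

Definition symmetrize u : Rn R m.+1 -> \bar R :=
  fun x => rearr (lebn R m.+1) u (supvol x).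

Lemma symmetrize_ge0 u x : 0 <= symmetrize u x. Proof. exact: rearr_ge0. Qed.

Lemma measurable_symmetrize u : measurable_fun setT (symmetrize u).
Proof.
exact: (measurableT_comp (measurable_rearr (lebn R m.+1) u measurableT) measurable_supvol).
Qed.

Lemma lt_symmetrize u y x : measurable_fun setT u -> (0 <= y)%R ->
  (y%:E < symmetrize u x) = ((supvol x)%:E < distrib (lebn R m.+1) u y).
Proof. by move=> mu y0; rewrite /symmetrize lt_rearr. Qed.

Lemma distrib_symmetrize u y : measurable_fun setT u -> (0 <= y)%R ->
  distrib (lebn R m.+1) (symmetrize u) y = distrib (lebn R m.+1) u y.
Proof.
move=> mu y0; rewrite -[RHS]supvol_measure; last exact: measure_ge0.
congr (L _); apply/funext => x; apply/propext => /=.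
by rewrite gee0_abs ?symmetrize_ge0// lt_symmetrize.
Qed.

Lemma rearr_symmetrize u t : measurable_fun setT u ->
  rearr (lebn R m.+1) (symmetrize u) t = rearr (lebn R m.+1) u t.
Proof. by move=> mu; apply: eq_rearr => y /ltW y0; exact: distrib_symmetrize. Qed.

(** At each level [y > 0] both sides have level sets of measure min(t, distrib u y): the one on the
    right is the cube centred at the origin of that volume. *)
Lemma intrearr_le_symmetrize u t : measurable_fun setT u -> (0 < t)%R ->
  F u t <= \int[L]_(x in [set x | (supvol x < t)%R]) symmetrize u x.
Proof.
move=> mu t0; have mS : measurable [set x | (supvol x < t)%R].
  exact: (measurable_supvol_lt t%:E).
have -> : F u t = \int[@lebesgue_measure R]_s cut_rearr L u t s.
  by rewrite int_cut_rearr.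
rewrite [leRHS]integral_mkcond.
apply: le_integral_level_sets1.
- exact: measurable_cut_rearr.
- by move=> s; exact: cut_rearr_ge0.
- apply/(measurable_restrictT _ mS); exact: measurable_funTS (measurable_symmetrize u).
- by move=> x; rewrite patchE; case: ifP => // _; exact: symmetrize_ge0.
move=> y y0; rewrite [X in X <= _](cut_rearr_level L mu t0 (ltW y0)).
rewrite -[leLHS]supvol_measure; last by rewrite le_min lee_fin (ltW t0) measure_ge0.
rewrite le_eqVlt; apply/orP; left; apply/eqP; congr (L _).
apply/funext => x; apply/propext; rewrite /mkset patchE lt_min lte_fin; case: ifPn.
- by rewrite inE/= => ->; rewrite lt_symmetrize// ltW.
- rewrite notin_setE/= => /negP/negbTE ->; rewrite /= lte_fin.
  by rewrite ltNge (ltW y0).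
Qed.

Variables (Phi : R -> R) (C : R).
Hypothesis Phi_le : forall r s, (0 < r)%R -> (r <= s)%R -> (Phi s <= Phi r)%R.
Hypothesis Phi_gt0 : forall r, (0 < r)%R -> (0 < Phi r)%R.
Hypothesis Phi_cont : forall r, (0 < r)%R -> {for r, continuous Phi}.
Hypothesis C_gt0 : (0 < C)%R.
Hypothesis Phi_int : forall r : R, (0 < r)%R ->
  \int[@lebesgue_measure R]_(s in `]0%R, r[%classic) (Phi s * s ^+ m)%:E
    <= (C * Phi r * r ^+ m.+1)%:E.

Local Notation c3 := ((2 * m.+2%:R) ^+ m.+1 * C)%R.

Lemma c3_gt0 : (0 < c3)%R.
Proof. by rewrite mulr_gt0// exprn_gt0// mulr_gt0. Qed.

Lemma frac_max_symmetrize_ge u t x : measurable_fun setT u -> (0 < t)%R ->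
  (supvol x < t)%R ->
  (Phi (nroot m t))%:E * F u t <= c3%:E * frac_max Phi (symmetrize u) x.
Proof.
(* Two points of the cube have squared distance at most (m+1) times the squared side, strictly less
   than (m+2)^2 times it. This avoids a square root and fits the cube into the open ball; [c3] is
   the doubling constant for the ratio m+2. *)
move=> mu t0 xt; pose r := (m.+2%:R * nroot m t)%R.
have rt0 : (0 < nroot m t)%R by exact: nroot_gt0.
have r0 : (0 < r)%R by rewrite mulr_gt0.
have sub : [set y | (supvol y < t)%R] `<=` @ball_n R m.+1 x r.
  move=> y /=; rewrite supvol_lt// => yt; rewrite supvol_lt// in xt.
  rewrite /ball_n/=; apply: (le_lt_trans (sqdist_le_cube xt yt)).
  rewrite (_ : (2 * (nroot m t / 2) = nroot m t)%R); last by field.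
  rewrite /r exprMn ltr_pM2r ?exprn_gt0// -natrX ltr_nat.
  by rewrite -[ltnLHS]expn1 (@leq_trans (m.+2 ^ 1))// leq_exp2l.
apply: (le_trans _ (lee_wpmul2l _ (frac_max_ge Phi (symmetrize u) x r0))); last first.
  by rewrite lee_fin ltW// c3_gt0.
rewrite muleA -EFinM; apply: lee_pmul.
- by rewrite lee_fin ltW// Phi_gt0.
- exact: intrearr_ge0.
- by rewrite lee_fin; apply: (Phi_doubling Phi_le Phi_gt0 Phi_int); rewrite ?ler1n.
apply: (le_trans (intrearr_le_symmetrize mu t0)).
under [leRHS]eq_integral do rewrite gee0_abs ?symmetrize_ge0//.
apply: (@ge0_subset_integral _ _ _ L) => //.
- exact: (measurable_supvol_lt t%:E).
- exact: measurable_ball_n.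
- exact: measurable_funTS (measurable_symmetrize u).
- by move=> y _; exact: symmetrize_ge0.
Qed.

(** For tau = v > t and [y] below the corresponding term, the maximal function exceeds y/c3 on a
    cube of volume [v]. Its distribution there is thus strictly above [t], which is what [lt_rearr]
    asks for. *)
Lemma K3fun_le_symmetrize u t : measurable_fun setT u -> (0 < t)%R ->
  @K3fun R m.+1 Phi u t <=
    c3%:E * rearr (lebn R m.+1) (frac_max Phi (symmetrize u)) t.
Proof.
move=> mu t0; have c30 := c3_gt0.
have mM := measurable_frac_max Phi_gt0 Phi_cont (measurable_symmetrize u).
apply: ge_ereal_sup => _ [v /= tv <-].
have v0 : (0 < v)%R by exact: lt_trans tv.
rewrite -[(v `^ _)%R]/(nroot m v) K3fun_termE//.
apply: le_by_pos_reals.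
  by rewrite mule_ge0 ?rearr_ge0// lee_fin ltW.
move=> y y0 yv; rewrite -lee_pdivrMl// -EFinM; apply: ltW.
rewrite lt_rearr//; last by rewrite mulr_ge0 ?invr_ge0 ?ltW.
apply: (@lt_le_trans _ _ v%:E); first by rewrite lte_fin.
rewrite -(supvol_measure_fin (ltW v0)); apply: le_measure; rewrite ?inE.
- exact: (measurable_supvol_lt v%:E).
- exact: measurable_distrib_set.
move=> x /= xv; rewrite gee0_abs ?frac_max_ge0// EFinM lte_pdivrMl//.
exact: lt_le_trans yv (frac_max_symmetrize_ge mu v0 xv).
Qed.

End lower_bound.

(** * Rearrangement-invariant norms and the abstract covering principle *)

Section function_norm.
Local Open Scope ereal_scope.
Context (R : realType) (m : nat) (rho : (Rn R m.+1 -> \bar R) -> \bar R).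
Hypothesis rho_ri : ri_norm (lebn R m.+1) rho.
Local Notation X := (ms_type (leb_space R m)).
Local Notation L := (@leb_sfinite R m).
Implicit Types (f g u v : Rn R m.+1 -> \bar R).

Let bfn := proj1 rho_ri.

Lemma rho_eq0 f : nonneg_meas f ->
  (rho f = 0 <-> {ae lebn R m.+1, forall x, f x = 0}).
Proof. by case: bfn => H _; exact: H. Qed.

Lemma rhoZ f (a : R) : nonneg_meas f -> (0 <= a)%R ->
  rho (fun x => a%:E * f x) = a%:E * rho f.
Proof. by case: bfn => _ [H _]; exact: H. Qed.

Lemma rhoD f g : nonneg_meas f -> nonneg_meas g ->
  rho (fun x => f x + g x) <= rho f + rho g.
Proof. by case: bfn => _ [_ [H _]]; exact: H. Qed.

Lemma le_rho f g : nonneg_meas f -> nonneg_meas g ->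
  (forall x, g x <= f x) -> rho g <= rho f.
Proof. by case: bfn => _ [_ [_ [H _]]] nf ng gf; apply: H => //; exact: aeW. Qed.

Lemma rho_monotone_limit_le (G : nat -> Rn R m.+1 -> \bar R) f (b : \bar R) :
  (forall k, nonneg_meas (G k)) -> nonneg_meas f ->
  (forall x, {homo (fun k => G k x) : k l / (k <= l)%N >-> k <= l}) ->
  (forall x, (fun k => G k x) @ \oo --> f x) ->
  (forall k, rho (G k) <= b) -> rho f <= b.
Proof.
case: bfn => _ [_ [_ [_ [H _]]]] nG nf homoG cG Gb.
have [|_ c] := H G f nG nf; first by apply: aeW => x; split; [exact: homoG|exact: cG].
rewrite -(cvg_lim _ c)//; apply: lime_le; first by apply/cvg_ex; eexists; exact: c.
exact: nearW.
Qed.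

Lemma rho_indic_lty (A : set (Rn R m.+1)) : measurable A -> lebn R m.+1 A < +oo ->
  rho (fun x => (\1_A x)%:E) < +oo.
Proof. by case: bfn => _ [_ [_ [_ [_ [H _]]]]]; exact: H. Qed.

Lemma nonneg_meas0 : nonneg_meas (fun _ : Rn R m.+1 => 0 : \bar R).
Proof. by split. Qed.

Lemma rho0 : rho (fun _ => 0) = 0.
Proof. by apply/(rho_eq0 nonneg_meas0); exact: aeW. Qed.

Lemma rho_ge0 f : nonneg_meas f -> 0 <= rho f.
Proof.
move=> nf; rewrite -rho0; apply: le_rho; [exact: nf|exact: nonneg_meas0|by case: nf].
Qed.

Lemma nonneg_meas_abs f : measurable_fun setT f -> nonneg_meas (fun x => `|f x|).
Proof. by move=> mf; split => //; exact: measurableT_comp. Qed.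

Lemma nonneg_measZ f (l : R) : (0 <= l)%R -> nonneg_meas f ->
  nonneg_meas (fun x => l%:E * f x).
Proof.
by move=> l0 [mf f0]; split; [exact: measurable_funeM|move=> x; rewrite mule_ge0].
Qed.

Lemma norm_E_nonneg f : nonneg_meas f -> norm_E rho f = rho f.
Proof. by move=> [_ f0]; congr rho; apply/funext => x; rewrite gee0_abs. Qed.

Lemma norm_E_ge0 f : in_E rho f -> 0 <= norm_E rho f.
Proof. by move=> [mf _]; exact: rho_ge0 (nonneg_meas_abs mf). Qed.

Lemma in_E_scale f (l : R) : (0 < l)%R -> nonneg_meas f -> in_E rho f ->
  in_E rho (fun x => l%:E * f x) /\
  norm_E rho (fun x => l%:E * f x) = l%:E * norm_E rho f.
Proof.
move=> l0 nf Ef; have nlf := nonneg_measZ (ltW l0) nf.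
have E : norm_E rho (fun x => l%:E * f x) = l%:E * norm_E rho f.
  by rewrite !norm_E_nonneg// rhoZ// ltW.
split => //; split; first by case: nlf.
rewrite -/(norm_E rho _) E; apply: lte_mul_pinfty => //; last by case: Ef.
by rewrite lee_fin ltW.
Qed.

Let Q k : set X := [set x | (supdist (@origin R m) x < k.+1%:R)%R].

Lemma truncation_in_E v k : nonneg_meas v ->
  in_E rho ((fun x => mine (v x) k%:R%:E) \_ (Q k)).
Proof.
move=> [mv v0]; have mQ : measurable (Q k) by exact: measurable_cube.
have nt : nonneg_meas ((fun x => mine (v x) k%:R%:E) \_ (Q k)).
  split; last by move=> x; rewrite patchE; case: ifP => // _; rewrite le_min v0 lee_fin ler0n.
  by apply/(measurable_restrictT _ mQ); apply: measurable_funTS; exact: measurable_mine.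
have nI : nonneg_meas (fun x : Rn R m.+1 => (\1_(Q k) x)%:E : \bar R).
  by split; [apply/measurable_EFinP; exact: measurable_indic|move=> x; rewrite lee_fin].
split; first by case: nt.
rewrite -/(norm_E rho _) norm_E_nonneg//.
apply: (@le_lt_trans _ _ (k%:R%:E * rho (fun x => (\1_(Q k) x)%:E))).
  rewrite -rhoZ//; apply: le_rho => //; first exact: nonneg_measZ.
  move=> x; rewrite patchE indicE; case: ifP => _.
  - by rewrite mule1 ge_min lexx orbT.
  - by rewrite mule0.
apply: lte_mul_pinfty => //.
apply: rho_indic_lty => //.
by rewrite [lebn R m.+1 _](cube_measure _ (ltr0Sn R k)) ltry.
Qed.

(** [ri_norm] cannot be applied to [v] before [v] is known to lie in E. The truncations of [v] at
    height k on growing cubes lie in E, are bounded in norm by [u], and increase to [v]. *)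
Lemma in_E_of_rearr u v : nonneg_meas v -> in_E rho u ->
  (forall t, (0 < t)%R -> rearr (lebn R m.+1) v t <= rearr (lebn R m.+1) u t) ->
  in_E rho v /\ norm_E rho v <= norm_E rho u.
Proof.
move=> nv Eu vu; have [mv v0] := nv.
pose w k := (fun x => mine (v x) k%:R%:E) \_ (Q k).
have Ew k : in_E rho (w k) by exact: truncation_in_E.
have w0 k x : 0 <= w k x.
  by rewrite /w patchE; case: ifP => // _; rewrite le_min v0 lee_fin ler0n.
have wv k x : w k x <= v x by rewrite /w patchE; case: ifP => // _; rewrite ge_min lexx.
have nw k : nonneg_meas (w k) by split => //; case: (Ew k).
have wu k : rho (w k) <= norm_E rho u.
  rewrite -norm_E_nonneg//; apply: (proj2 rho_ri) => // t t0.
  apply: le_trans (vu t t0); apply: le_rearr => //; first by case: (Ew k).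
  by move=> x; rewrite !gee0_abs.
have homow x : {homo (fun k => w k x) : k l / (k <= l)%N >-> k <= l}.
  move=> k l kl; rewrite [leLHS]patchE; case: ifPn => [|_]; last exact: w0.
  rewrite inE /Q/= => xk; rewrite /w patchE mem_set; last first.
    by rewrite /Q/=; apply: (lt_le_trans xk); rewrite ler_nat ltnS.
  by rewrite le_min ge_min lexx/= ge_min lee_fin ler_nat kl orbT.
suff vN : norm_E rho v <= norm_E rho u.
  by split => //; split => //; apply: le_lt_trans vN _; case: Eu.
rewrite norm_E_nonneg//; apply: (@rho_monotone_limit_le w) => // x.
have cw := ereal_nondecreasing_cvgn (homow x).
suff <- : ereal_sup (range (fun k => w k x)) = v x by exact: cw.
apply/eqP; rewrite eq_le; apply/andP; split.
  by apply: ge_ereal_sup => _ [k _ <-]; exact: wv.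
apply: le_by_pos_reals; first by apply: le_trans (w0 0%N x) _; apply: ereal_sup_ubound; exists 0%N.
(* One index serves twice: the height k+1 exceeds [y], and the cube of the truncation contains
   [x]. *)
move=> y y0 yv; pose k := Num.truncn (Num.max y (supdist (@origin R m) x)).
have [yk dk] : (y < k.+1%:R)%R /\ (supdist (@origin R m) x < k.+1%:R)%R.
  have := truncnS_gt (Num.max y (supdist (@origin R m) x)).
  by rewrite gt_max => /andP.
apply: (@le_trans _ _ (w k.+1 x)); last by apply: ereal_sup_ubound; exists k.+1.
rewrite /w patchE mem_set.
  by rewrite le_min (ltW yv) lee_fin ltW.
by rewrite /Q/=; apply: (lt_trans dk); rewrite ltr_nat.
Qed.

(* K1, K2 and K3 are all of this form, with A f = (M_Phi f)^*, (M_Phi f)^** and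
   K3fun f; the nested infima of K1 and K2 collapse into one. *)
Definition op_mem (A : (Rn R m.+1 -> \bar R) -> R -> \bar R) (h : R -> \bar R) :=
  exists f, in_E rho f /\ forall t, (0 < t)%R -> h t = A f t.

Definition op_rho (A : (Rn R m.+1 -> \bar R) -> R -> \bar R) (h : R -> \bar R) :=
  ereal_inf [set norm_E rho f | f in
    [set f | in_E rho f /\ forall t, (0 < t)%R -> A f t = h t]].

Lemma op_rho_ge0 A h : 0 <= op_rho A h.
Proof. by apply: le_ereal_inf_tmp => _ [f [Ef _] <-]; exact: norm_E_ge0. Qed.

Lemma op_rho_le A h f : in_E rho f -> (forall t, (0 < t)%R -> A f t = h t) ->
  op_rho A h <= norm_E rho f.
Proof. by move=> Ef fh; apply: ereal_inf_lbound; exists f. Qed.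

Section operator_cones.
Variables (A B : (Rn R m.+1 -> \bar R) -> R -> \bar R) (c : R).
Hypothesis c_gt0 : (0 < c)%R.
Hypothesis A_dichotomy : forall f, in_E rho f ->
  (forall t, (0 < t)%R -> A f t = 0) \/ (forall t, (0 < t)%R -> 0 < A f t).
Hypothesis B_ge0 : forall f t, (0 < t)%R -> 0 <= B f t.
Hypothesis le_B : forall f g t, nonneg_meas f -> nonneg_meas g ->
  (forall x, f x <= g x) -> (0 < t)%R -> B f t <= B g t.
Hypothesis BZ_ge : forall f (l : R) t, nonneg_meas f -> (0 < l)%R -> (0 < t)%R ->
  l%:E * B f t <= B (fun x => l%:E * f x) t.
Hypothesis A_le_B : forall f, in_E rho f -> exists g,
  [/\ nonneg_meas g, in_E rho g, norm_E rho g <= c%:E * norm_E rho f &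
      forall t, (0 < t)%R -> A f t <= B g t].

(* The infimum defining op_rho A h may vanish for h != 0. Dominating elements g_k
   of norm <= c 4^-k then exist, sum_k 2^k g_k has finite norm and B-image
   identically +oo, and so have all its positive multiples. *)
Lemma op_rho_infty h : (forall t, (0 < t)%R -> 0 < h t) -> op_rho A h = 0 ->
  op_mem B (fun _ => +oo) /\ op_rho B (fun _ => +oo) <= 0.
Proof.
move=> h0 Ah0.
have /choice[g Hg] : forall k : nat, exists g, [/\ nonneg_meas g,
    rho g <= (c * (4^-1) ^+ k)%:E & forall t, (0 < t)%R -> h t <= B g t].
  move=> k; have e0 : op_rho A h < ((4^-1) ^+ k)%:E.
    by rewrite Ah0 lte_fin exprn_gt0// invr_gt0.
  have [_ [f [Ef fh] <-] fe] := ereal_inf_lt e0.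
  have [g [ng Eg gf AB]] := A_le_B Ef; exists g; split => //.
  - rewrite -norm_E_nonneg//; apply: (le_trans gf); rewrite EFinM.
    by apply: lee_wpmul2l; rewrite ?lee_fin; exact: ltW.
  - by move=> t t0; rewrite -fh// AB.
have ng k : nonneg_meas (g k) by case: (Hg k).
pose w k x := (2 ^+ k)%:E * g k x.
have nw k : nonneg_meas (w k) by apply: nonneg_measZ; rewrite ?exprn_ge0.
pose S n x := \sum_(0 <= k < n) w k x.
pose G x := \sum_(k <oo) w k x.
have nS n : nonneg_meas (S n).
  split; last by move=> x; apply: sume_ge0 => k _; case: (nw k).
  by apply: emeasurable_sum => k; case: (nw k).
have cS x : (fun n => S n x) @ \oo --> G x.
  by apply: is_cvg_nneseries => k _ _; case: (nw k).
have nG : nonneg_meas G.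
  split; last by move=> x; apply: nneseries_ge0 => k _ _; case: (nw k).
  apply: (emeasurable_fun_cvg S) => [n|x _]; [by case: (nS n)|exact: cS].
(* Closed form of the geometric sum of c 2^k 4^(-k) over k < n. *)
have rS n : rho (S n) <= (c * (2 - 2 * (2^-1) ^+ n))%:E.
  elim: n => [|n ih].
    rewrite (_ : S 0%N = fun _ => 0) ?rho0 ?lee_fin; first by rewrite expr0 mulr1 subrr mulr0.
    by apply/funext => x; rewrite /S big_geq.
  rewrite (_ : S n.+1 = fun x => S n x + w n x); last first.
    by apply/funext => x; rewrite /S big_nat_recr.
  apply: (le_trans (rhoD (nS n) (nw n))).
  apply: (le_trans (leeD ih (_ : _ <= ((2 ^+ n) * (c * (4^-1) ^+ n))%:E))).
    rewrite rhoZ ?exprn_ge0// EFinM lee_wpmul2l ?lee_fin ?exprn_ge0//.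
    by case: (Hg n).
  rewrite -EFinD lee_fin le_eqVlt; apply/orP; left; apply/eqP.
  have -> : ((4^-1) ^+ n = (2^-1) ^+ n * (2^-1) ^+ n :> R)%R.
    by rewrite -exprMn -invfM -natrM.
  have E : (2 ^+ n * (2^-1) ^+ n = 1 :> R)%R by rewrite -exprMn divff// expr1n.
  rewrite exprSr; transitivity (c * (2 - 2 * 2^-1 ^+ n) +
    c * ((2 ^+ n * 2^-1 ^+ n) * 2^-1 ^+ n))%R; first by ring.
  by rewrite E; field.
have rG : rho G <= (2 * c)%:E.
  apply: (@rho_monotone_limit_le S) => // [x n k nk|n].
    by apply: lee_sum_nneg_natr => // i _ _; case: (nw i).
  apply: (le_trans (rS n)); rewrite lee_fin mulrC ler_wpM2r ?(ltW c_gt0)//.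
  by rewrite gerDl oppr_le0 mulr_ge0// exprn_ge0// invr_ge0.
have EG : in_E rho G.
  split; first by case: nG.
  by rewrite -/(norm_E rho G) norm_E_nonneg// (le_lt_trans rG) ?ltry.
have BG t : (0 < t)%R -> B G t = +oo.
  move=> t0; apply/eqP; rewrite -leye_eq; apply: le_by_pos_reals; first exact: B_ge0.
  move=> y y0 _.
  have [e e0 eh] : exists2 e : R, (0 < e)%R & e%:E <= h t.
    have := h0 t t0; case: (h t) => [r| |]//; first by rewrite lte_fin => r0; exists r.
    by move=> _; exists 1%R; rewrite ?leey.
  (* [G] dominates its term 2^k g_k, so its B-image at [t] is at least 2^k h(t); this [k] makes 2^k
     e at least [y]. *)
  pose k := Num.truncn (y / e).
  have yk : (y <= 2 ^+ k * e)%R.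
    rewrite -ler_pdivrMr//; apply: (le_trans (ltW (truncnS_gt (y / e)))).
    by rewrite -natrX ler_nat ltn_expl.
  apply: (@le_trans _ _ ((2 ^+ k)%:E * e%:E)); first by rewrite -EFinM lee_fin.
  apply: (@le_trans _ _ ((2 ^+ k)%:E * B (g k) t)).
    rewrite lee_wpmul2l ?lee_fin ?exprn_ge0//; apply: (le_trans eh).
    by case: (Hg k) => _ _; exact.
  apply: le_trans (BZ_ge (ng k) (exprn_gt0 k (ltr0n R 2)) t0) _.
  apply: le_B => //; first exact: (nw k).
  move=> x; apply: le_trans (nneseries_lim_ge k.+1 _).
    by rewrite big_nat_recr//= leeDr// sume_ge0// => i _; case: (nw i).
  by move=> i _ _; case: (nw i).
split; first by exists G; split => // t t0; rewrite BG.
apply/lee_addgt0Pr => e e0; rewrite add0e.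
(* Scales the norm of [G], at most 2c, down to at most [e]; the B-image stays +oo. *)
pose l := (e / (2 * c))%R; have l0 : (0 < l)%R by rewrite divr_gt0// mulr_gt0.
have [ElG NlG] := in_E_scale l0 nG EG.
have BlG t : (0 < t)%R -> B (fun x => l%:E * G x) t = +oo.
  move=> t0; apply/eqP; rewrite -leye_eq; apply: le_trans (BZ_ge nG l0 t0).
  by rewrite BG// gt0_muley.
apply: (le_trans (op_rho_le ElG BlG)); rewrite NlG norm_E_nonneg//.
apply: (le_trans (lee_wpmul2l _ rG)); first by rewrite lee_fin ltW.
by rewrite -EFinM lee_fin /l divfK// gt_eqF// mulr_gt0.
Qed.

(** Turns a pointwise domination of [A] by [B] into a covering. The factor 2 pays for an infimum
    that need not be attained. *)
Lemma op_cover h1 : op_mem A h1 -> exists h2,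
  [/\ op_mem B h2, op_rho B h2 <= (2 * c)%:E * op_rho A h1 &
      forall t, (0 < t)%R -> h1 t <= h2 t].
Proof.
move=> [f0 [Ef0 h1f0]].
have := op_rho_ge0 A h1; rewrite le_eqVlt => /predU1P[z|r0].
  (* With functional 0, [h1] is either 0, covered by the B-image of 0, or positive everywhere,
     covered by +oo. *)
  case: (A_dichotomy Ef0) => [A0|Apos].
    exists (B (fun _ => 0)).
    have E0 : in_E rho (fun _ => 0).
      by split => //; under eq_fun do rewrite abse0; rewrite rho0.
    split; first by exists (fun _ => 0).
      rewrite -z mule0; apply: (le_trans (op_rho_le E0 _)) => //.
      by rewrite norm_E_nonneg ?rho0//; exact: nonneg_meas0.
    by move=> t t0; rewrite h1f0// A0// B_ge0.
  have [|mB rB] := @op_rho_infty h1 _ (esym z); first by move=> t t0; rewrite h1f0// Apos.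
  exists (fun _ => +oo); split => //; first by rewrite -z mule0.
  by move=> t _; rewrite leey.
have rfin : op_rho A h1 \is a fin_num.
  rewrite ge0_fin_numE ?op_rho_ge0//.
  apply: (@le_lt_trans _ _ (norm_E rho f0)); last by case: Ef0.
  by apply: op_rho_le => // t t0; rewrite h1f0.
(* Strict because the infimum is positive and finite; it provides an almost minimal generator. *)
have rlt : op_rho A h1 < 2%:E * op_rho A h1.
  by rewrite -(fineK rfin) -EFinM lte_fin ltr_pMl ?ltr1n// fine_gt0// r0 ltey_eq rfin.
have [_ [f [Ef fh] <-] fr] := ereal_inf_lt rlt.
have [g [ng Eg gf AB]] := A_le_B Ef.
exists (B g); split; first by exists g.
  apply: (le_trans (op_rho_le Eg _)) => //; apply: (le_trans gf).
  rewrite mulrC EFinM -muleA; apply: lee_wpmul2l; first by rewrite lee_fin ltW.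
  exact: ltW.
by move=> t t0; rewrite -fh// AB.
Qed.

End operator_cones.
End function_norm.

(** * The three coverings *)

Section cone_operators.
Local Open Scope ereal_scope.
Context (R : realType) (m : nat) (Phi : R -> R).
Hypothesis Phi_gt0 : forall r, (0 < r)%R -> (0 < Phi r)%R.
Hypothesis Phi_cont : forall r, (0 < r)%R -> {for r, continuous Phi}.
Local Notation KF := (@K3fun R m.+1 Phi).
Implicit Types (f g : Rn R m.+1 -> \bar R).

Lemma le_frac_max f g x : measurable_fun setT f -> measurable_fun setT g ->
  (forall y, `|f y| <= `|g y|) -> frac_max Phi f x <= frac_max Phi g x.
Proof.
move=> mf mg fg; apply: ge_ereal_sup => _ [r /= r0 <-].
apply: (le_trans _ (frac_max_ge Phi g x r0)); apply: lee_wpmul2l.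
  by rewrite lee_fin ltW// Phi_gt0.
apply: ge0_le_integral => //.
- exact: measurable_ball_n.
- by apply: measurable_funTS; exact: measurableT_comp.
- by apply: measurable_funTS; exact: measurableT_comp.
Qed.

Lemma frac_max_scale_ge f (l : R) x : measurable_fun setT f -> (0 < l)%R ->
  l%:E * frac_max Phi f x <= frac_max Phi (fun y => l%:E * f y) x.
Proof.
move=> mf l0; rewrite -lee_pdivlMl//; apply: ge_ereal_sup => _ [r /= r0 <-].
rewrite lee_pdivlMl//; apply: (le_trans _ (frac_max_ge Phi _ x r0)).
rewrite muleCA; apply: lee_wpmul2l; first by rewrite lee_fin ltW// Phi_gt0.
under [leRHS]eq_integral do rewrite abseM (gee0_abs (_ : 0 <= l%:E)) ?lee_fin ?ltW//.
rewrite ge0_integralZl_EFin ?(ltW l0)//.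
- exact: measurable_ball_n.
- by apply: measurable_funTS; exact: measurableT_comp.
Qed.

Lemma le_rearr_frac_max f g t : measurable_fun setT f -> measurable_fun setT g ->
  (forall y, `|f y| <= `|g y|) ->
  rearr (lebn R m.+1) (frac_max Phi f) t <= rearr (lebn R m.+1) (frac_max Phi g) t.
Proof.
move=> mf mg fg; apply: le_rearr; [exact: measurable_frac_max..|].
by move=> x; rewrite !gee0_abs ?frac_max_ge0//; exact: le_frac_max.
Qed.

Lemma rearr_frac_max_scale_ge f (l : R) t : measurable_fun setT f -> (0 < l)%R ->
  l%:E * rearr (lebn R m.+1) (frac_max Phi f) t <=
  rearr (lebn R m.+1) (frac_max Phi (fun y => l%:E * f y)) t.
Proof.
move=> mf l0; apply: (le_trans (rearr_scale_le _ _ _ l0)).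
apply: le_rearr.
- by apply: measurable_funeM; exact: measurable_frac_max.
- by apply: measurable_frac_max => //; exact: measurable_funeM.
- move=> x; rewrite !gee0_abs ?mule_ge0 ?frac_max_ge0 ?lee_fin ?(ltW l0)//.
  exact: frac_max_scale_ge.
Qed.

Lemma le_K3fun f g t : measurable_fun setT f -> measurable_fun setT g ->
  (forall y, `|f y| <= `|g y|) -> (0 < t)%R -> KF f t <= KF g t.
Proof.
move=> mf mg fg t0; apply: ge_ereal_sup => _ [u /= tu <-].
have u0 : (0 < u)%R by exact: lt_trans tu.
rewrite -[(u `^ _)%R]/(nroot m u) K3fun_termE//.
apply: le_trans (K3fun_ge Phi g t0 tu); apply: lee_wpmul2l; last exact: le_intrearr.
by rewrite lee_fin ltW// Phi_gt0// nroot_gt0.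
Qed.

Lemma K3fun_scale_ge f (l : R) t : measurable_fun setT f -> (0 < l)%R -> (0 < t)%R ->
  l%:E * KF f t <= KF (fun y => l%:E * f y) t.
Proof.
move=> mf l0 t0; rewrite -lee_pdivlMl//; apply: ge_ereal_sup => _ [u /= tu <-].
have u0 : (0 < u)%R by exact: lt_trans tu.
rewrite -[(u `^ _)%R]/(nroot m u) K3fun_termE// lee_pdivlMl//.
apply: le_trans (K3fun_ge Phi _ t0 tu); rewrite muleCA; apply: lee_wpmul2l.
  by rewrite lee_fin ltW// Phi_gt0// nroot_gt0.
exact: intrearr_scale_le.
Qed.

Lemma rearr2_dichotomy (v : Rn R m.+1 -> \bar R) :
  (forall t, (0 < t)%R -> rearr2 (lebn R m.+1) v t = 0) \/
  (forall t, (0 < t)%R -> 0 < rearr2 (lebn R m.+1) v t).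
Proof.
have [[t t0 vt]|H] := pselect (exists2 t : R, (0 < t)%R & rearr2 (lebn R m.+1) v t = 0).
  by left => s s0; have [] := rearr2_eq0 t0 vt s0.
right => t t0; rewrite lt_neqAle rearr2_ge0// andbT; apply/eqP => vt.
by apply: H; exists t.
Qed.

Lemma K3fun_dichotomy f :
  (forall t, (0 < t)%R -> KF f t = 0) \/ (forall t, (0 < t)%R -> 0 < KF f t).
Proof.
have [f0|fpos] := rearr2_dichotomy f; [left|right] => t t0.
- apply/eqP; rewrite eq_le K3fun_ge0// andbT.
  apply: ge_ereal_sup => _ [u /= tu <-].
  by rewrite f0 ?mule0// (lt_trans t0).
- have tt : (t < 2 * t)%R by rewrite ltr_pMl// ltr1n.
  have t2 : (0 < 2 * t)%R by rewrite mulr_gt0.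
  apply: lt_le_trans (K3fun_ge Phi f t0 tt).
  by rewrite -K3fun_termE// mule_gt0 ?fpos// lte_fin mulr_gt0// Phi_gt0// nroot_gt0.
Qed.

Variable rho : (Rn R m.+1 -> \bar R) -> \bar R.

(** Here K1 is to serve as a covering cone, so its functional must be bounded from above;
    [le_K2_rho] bounds that of K2 from below because K2 is then the covered cone. *)
Lemma K1_rho_le h :
  cone_rho (K1 rho Phi) h <= op_rho rho (fun f => rearr (lebn R m.+1) (frac_max Phi f)) h.
Proof.
apply: le_ereal_inf_tmp => _ [f [Ef fh] <-].
apply: (@le_trans _ _ (norm_MEPhi rho Phi (frac_max Phi f))).
  by apply: ereal_inf_lbound; exists (frac_max Phi f) => //; split => //; exists f.
by apply: ereal_inf_lbound; exists f.
Qed.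

Lemma le_K2_rho h :
  op_rho rho (fun f => rearr2 (lebn R m.+1) (frac_max Phi f)) h <= cone_rho (K2 rho Phi) h.
Proof.
apply: le_ereal_inf_tmp => _ [u [_ uh] <-].
apply: le_ereal_inf_tmp => _ [f [Ef fu] <-].
by apply: op_rho_le => // t t0; rewrite fu uh.
Qed.

(** Constant 1: functions with the same rearrangement have the same [rearr2], so the infimum on the
    K2 side runs over at least as many functions. *)
Lemma K1_covered_by_K2 : Defs.covered_by (K1 rho Phi) (K2 rho Phi).
Proof.
exists 1%R; split => // h1 [u [Mu h1u]]; exists (rearr2 (lebn R m.+1) u).
split; first by exists u.
split; last by move=> t t0; rewrite h1u// rearr_le_rearr2.
rewrite mul1e; apply: le_ereal_inf_tmp => _ [v [Mv vh] <-].
apply: ereal_inf_lbound; exists v => //; split => // t t0; congr (_ * _).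
by apply: eq_intrearr => s s0; rewrite vh// h1u.
Qed.

Hypothesis rho_ri : ri_norm (lebn R m.+1) rho.
Hypothesis Phi_le : forall r s, (0 < r)%R -> (r <= s)%R -> (Phi s <= Phi r)%R.
Variable C : R.
Hypothesis C_gt0 : (0 < C)%R.
Hypothesis Phi_int : forall r : R, (0 < r)%R ->
  \int[@lebesgue_measure R]_(s in `]0%R, r[%classic) (Phi s * s ^+ m)%:E
    <= (C * Phi r * r ^+ m.+1)%:E.

Lemma K2_covered_by_K3 : Defs.covered_by (K2 rho Phi) (K3 rho Phi).
Proof.
pose c4 := (4 ^+ m.+1 * C)%R.
pose c := ((8 ^+ m.+1 * C + 1) * (16 ^+ m.+1 * C) * c4 + c4 * (c4 + 1))%R.
have c40 : (0 < c4)%R by rewrite mulr_gt0// exprn_gt0.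
have c0 : (0 < c)%R.
  rewrite addr_gt0// mulr_gt0// ?addr_gt0//.
  by rewrite mulr_gt0 ?addr_gt0// mulr_gt0// exprn_gt0.
have cover h1 : op_mem rho (fun f => rearr2 (lebn R m.+1) (frac_max Phi f)) h1 ->
    exists h2, [/\ op_mem rho KF h2, op_rho rho KF h2 <=
      (2 * c)%:E * op_rho rho (fun f => rearr2 (lebn R m.+1) (frac_max Phi f)) h1 &
      forall t, (0 < t)%R -> h1 t <= h2 t].
  apply: op_cover => //.
  - by move=> f _; exact: rearr2_dichotomy.
  - by move=> f t; exact: K3fun_ge0.
  - move=> f g t [mf f0] [mg g0] fg t0; apply: le_K3fun => // x.
    by rewrite !gee0_abs.
  - by move=> f l t [mf _] l0 t0; exact: K3fun_scale_ge.
  - move=> f Ef; have [mf _] := Ef.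
    have nf := nonneg_meas_abs mf.
    have Efa : in_E rho (fun x => `|f x|).
      split; first by case: nf.
      by under eq_fun do rewrite abse_id; case: Ef.
    have [Eg Ng] := in_E_scale rho_ri c0 nf Efa.
    (* The constant of [rearr2_frac_max_le] is absorbed into the witness by homogeneity, and the
       absolute value makes it nonnegative without changing norm or rearrangement. *)
    exists (fun x => c%:E * `|f x|); split => //.
    + exact: nonneg_measZ (ltW c0) nf.
    + rewrite Ng; apply: lee_wpmul2l; first by rewrite lee_fin ltW.
      by rewrite /norm_E; under eq_fun do rewrite abse_id.
    + move=> t t0.
      apply: (le_trans (rearr2_frac_max_le Phi_le Phi_gt0 Phi_cont C_gt0 Phi_int mf t0)).
      apply: (le_trans _ (K3fun_scale_ge _ c0 t0)); last by case: nf.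
      apply: lee_wpmul2l; first by rewrite lee_fin ltW.
      by apply: le_K3fun => //; [case: nf|move=> x; rewrite abse_id].
exists (2 * c)%R; split; first by rewrite mulr_gt0.
move=> h1 [u [[f [Ef fu]] h1u]].
have [|h2 [h2m h2r h12]] := cover h1; first by exists f; split => // t t0; rewrite fu h1u.
exists h2; split => //; split => //; apply: (le_trans h2r).
by apply: lee_wpmul2l; [rewrite lee_fin ltW// mulr_gt0|exact: le_K2_rho].
Qed.

Lemma K3_covered_by_K1 : Defs.covered_by (K3 rho Phi) (K1 rho Phi).
Proof.
pose c := ((2 * m.+2%:R) ^+ m.+1 * C)%R.
have c0 : (0 < c)%R by exact: c3_gt0.
have cover h1 : op_mem rho KF h1 -> exists h2,
    [/\ op_mem rho (fun f => rearr (lebn R m.+1) (frac_max Phi f)) h2,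
      op_rho rho (fun f => rearr (lebn R m.+1) (frac_max Phi f)) h2 <=
        (2 * c)%:E * op_rho rho KF h1 &
      forall t, (0 < t)%R -> h1 t <= h2 t].
  apply: op_cover => //.
  - by move=> f _; exact: K3fun_dichotomy.
  - by move=> f t _; exact: rearr_ge0.
  - move=> f g t [mf f0] [mg g0] fg _; apply: le_rearr_frac_max => // x.
    by rewrite !gee0_abs.
  - by move=> f l t [mf _] l0 _; exact: rearr_frac_max_scale_ge.
  - move=> u Eu; have [mu _] := Eu.
    have ns : nonneg_meas (symmetrize u).
      by split; [exact: measurable_symmetrize|move=> x; exact: symmetrize_ge0].
    have [Es Ns] : in_E rho (symmetrize u) /\ norm_E rho (symmetrize u) <= norm_E rho u.
      by apply: (in_E_of_rearr rho_ri) => // t _; rewrite rearr_symmetrize.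
    have [Eg Ng] := in_E_scale rho_ri c0 ns Es.
    exists (fun x => c%:E * symmetrize u x); split => //.
    + exact: nonneg_measZ (ltW c0) ns.
    + by rewrite Ng; apply: lee_wpmul2l => //; rewrite lee_fin ltW.
    + move=> t t0.
      apply: (le_trans (K3fun_le_symmetrize Phi_le Phi_gt0 Phi_cont C_gt0 Phi_int mu t0)).
      by apply: rearr_frac_max_scale_ge => //; case: ns.
exists (2 * c)%R; split; first by rewrite mulr_gt0.
move=> h1 h1K; have [|h2 [[f [Ef fh2]] h2r h12]] := cover h1; first exact: h1K.
exists h2; split; last by split => //; exact: le_trans (K1_rho_le h2) h2r.
by exists (frac_max Phi f); split => //; exists f.
Qed.

End cone_operators.

Lemma covered_by_trans (R : realType) (K M N : cone R) :
  Defs.covered_by K M -> Defs.covered_by M N -> Defs.covered_by K N.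
Proof.
move=> [c [c0 KM]] [d [d0 MN]]; exists (d * c)%R; split; first exact: mulr_gt0.
move=> h1 /KM[h2 [/MN[h3 [Nh3 [r3 h23]]] [r2 h12]]]; exists h3; split => //; split.
- rewrite EFinM -muleA; apply: (le_trans r3); apply: lee_wpmul2l => //.
  by rewrite lee_fin ltW.
- by move=> t t0; apply: le_trans (h12 t t0) (h23 t t0).
Qed.

Unset Implicit Arguments.

Theorem theorem3p5 (R : realType) (n : nat)
    (rho : (Rn R n -> \bar R) -> \bar R) (Phi : R -> R) :
  (0 < n)%N ->
  ri_norm (lebn R n) rho ->
  class_Bn n Phi ->
  cone_equiv (K1 rho Phi) (K2 rho Phi) /\
  cone_equiv (K2 rho Phi) (K3 rho Phi) /\
  cone_equiv (K1 rho Phi) (K3 rho Phi).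
Proof.
case: n rho => [//|m] rho _ rho_ri [Phi_le [Phi_gt0 [Phi_cont [C [C0 Phi_int]]]]].
(* The coverings close the cycle K1, K2, K3, K1; each remaining direction is a composition of two of
   them. *)
have K12 := @K1_covered_by_K2 R m Phi rho.
have K23 : Defs.covered_by (K2 rho Phi) (K3 rho Phi).
  exact: (K2_covered_by_K3 Phi_gt0 Phi_cont rho_ri Phi_le C0 Phi_int).
have K31 : Defs.covered_by (K3 rho Phi) (K1 rho Phi).
  exact: (K3_covered_by_K1 Phi_gt0 Phi_cont rho_ri Phi_le C0 Phi_int).
split; first by split=> //; exact: covered_by_trans K23 K31.
split; split => //; first exact: covered_by_trans K31 K12.
exact: covered_by_trans K12 K23.
Qed.
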